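(* Let $n\ge 1$ and $1<p<\infty$. There exists a constant $C=C(n,p)>0$ depending only on $n$ and $p$ such that for every $0<s<1$ and every $f\in C_c^\infty(\mathbb{H}^n_+)$, $$\frac{C}{s(1-s)}\int_{\mathbb{H}^n_+}\frac{|f(\xi)|^p}{x_1^{sp}}\,d\xi\le \int_{\mathbb{H}^n}\int_{\mathbb{H}^n}\frac{|f(\xi)-f(\xi')|^p}{d(\xi^{-1}\circ\xi')^{Q+sp}}\,d\xi'\,d\xi,$$ where $\xi=(x_1,\ldots,x_n,y_1,\ldots,y_n,t)$.
   Context: The Heisenberg group $\mathbb{H}^n$ ($n\ge1$) is $\mathbb{R}^n\times\mathbb{R}^n\times\mathbb{R}$ with points $\xi=(z,t)=(x,y,t)$, $z=(x,y)$, and group law $\xi\circ\xi'=(x+x',\,y+y',\,t+t'+2\langle y,x'\rangle-2\langle x,y'\rangle)$; the inverse is $\xi^{-1}=-\xi$. The homogeneous norm is $d(\xi)=(|z|^4+t^2)^{1/4}$, and $Q=2n+2$ is the homogeneous dimension. $d\xi$ is Lebesgue measure on $\mathbb{R}^{2n+1}$. The half-space is $\mathbb{H}^n_+=\{\xi=(x,y,t)\in\mathbb{H}^n: x_1>0\}$. Functions in $C_c^\infty(\mathbb{H}^n_+)$ are extended by zero to $\mathbb{H}^n$. *)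

(* Defs.v *)
From HB Require Import structures.
From mathcomp Require Import all_boot all_order all_algebra.
From mathcomp Require Import all_classical all_reals all_analysis.
Import Order.TTheory GRing.Theory Num.Theory.
Import numFieldNormedType.Exports.

Set Implicit Arguments.
Unset Strict Implicit.
Unset Printing Implicit Defensive.

Local Open Scope classical_set_scope.
Local Open Scope ring_scope.

(* The sigma-algebra on row vectors generated by the coordinate maps, as the
   library does for tuples; for R : realType it is the Borel sigma-algebra
   of R^n. *)
Section measurable_row_vector.
Variables (R : realType) (n : nat).

Definition rV_coord (i : 'I_n) (v : 'rV[R]_n) : R := v ord0 i.

Let rV_set0 : g_sigma_preimage rV_coord set0.
Proof. exact: sigma_algebra0. Qed.

Let rV_setC A : g_sigma_preimage rV_coord A -> g_sigma_preimage rV_coord (~` A).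
Proof. exact: sigma_algebraC. Qed.

Let rV_bigcup (F : (set 'rV[R]_n)^nat) :
  (forall i, g_sigma_preimage rV_coord (F i)) ->
  g_sigma_preimage rV_coord (\bigcup_i (F i)).
Proof. exact: sigma_algebra_bigcup. Qed.

HB.instance Definition _ := @isMeasurable.Build default_measure_display
  'rV[R]_n (g_sigma_preimage rV_coord) rV_set0 rV_setC rV_bigcup.

End measurable_row_vector.

Lemma measurable_rV_coord (R : realType) n (i : 'I_n) :
  measurable_fun [set: 'rV[R]_n] (@rV_coord R n i).
Proof.
move=> _ Y mY; rewrite setTI; apply: sub_sigma_algebra => /=.
rewrite -bigcup_seq/=; exists i => /=; first by rewrite mem_index_enum.
by exists Y => //; rewrite setTI.
Qed.

Lemma measurable_fun_rVP d (T : measurableType d) (R : realType) n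
    (f : T -> 'rV[R]_n) :
  (forall i, measurable_fun setT (@rV_coord R n i \o f)) ->
  measurable_fun setT f.
Proof.
move=> mf.
suff : g_sigma_preimage (fun i => @rV_coord R n i \o f) `<=` measurable.
  by rewrite g_sigma_preimage_comp => prefS _ A mA; apply: prefS; exists A.
apply: smallest_sub; first exact: sigma_algebra_measurable.
case: n => [|n] in f mf *; first by rewrite big_ord0.
rewrite -bigcup_mkord_ord; apply: bigcup_sub => i Ii.
by move=> A [B mB <-]; exact: mf.
Qed.

Lemma measurable_rV_box (R : realType) n (A : 'I_n -> set R) :
    (forall i, measurable (A i)) ->
  measurable [set v : 'rV[R]_n | forall i, A i (v ord0 i)].
Proof.
move=> mA; rewrite (_ : [set _ | _] =
    \bigcap_(i in [set: 'I_n]) (@rV_coord R n i @^-1` A i)); last first.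
  by apply/seteqP; split => v /= Av i; [move=> _|]; exact: Av.
apply: fin_bigcap_measurable => // i _; rewrite -[X in measurable X]setTI.
exact: measurable_rV_coord.
Qed.

(* The library declares m1 \x m2 sigma-finite, but that canonical instance is
   shadowed by the one for subprobabilities. *)
Section product_sigma_finite_measure.
Context d1 d2 (T1 : measurableType d1) (T2 : measurableType d2) (R : realType).
Variables (m1 : {sigma_finite_measure set T1 -> \bar R})
          (m2 : {sigma_finite_measure set T2 -> \bar R}).

Definition sigma_finite_product : set (T1 * T2) -> \bar R := (m1 \x m2)%E.

Let product0 : sigma_finite_product set0 = 0%E.
Proof. exact: measure0. Qed.

Let product_ge0 A : (0 <= sigma_finite_product A)%E.
Proof. exact: measure_ge0. Qed.

Let product_sigma_additive : semi_sigma_additive sigma_finite_product.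
Proof. exact: measure_semi_sigma_additive. Qed.

HB.instance Definition _ := isMeasure.Build _ _ _ sigma_finite_product
  product0 product_ge0 product_sigma_additive.

Lemma sigma_finite_productT : sigma_finite setT sigma_finite_product.
Proof.
have /sigma_finiteP[F [TF ndF Foo]] := sigma_finiteT m1.
have /sigma_finiteP[G [TG ndG Goo]] := sigma_finiteT m2.
exists (fun n => F n `*` G n).
  rewrite -setXTT TF TG predeqE => -[x y]; split.
    move=> [/= [n _ Fnx] [k _ Gky]]; exists (maxn n k) => //; split.
      by move: x Fnx; exact/subsetPset/ndF/leq_maxl.
    by move: y Gky; exact/subsetPset/ndG/leq_maxr.
  by move=> [n _ []/= ? ?]; split; exists n.
move=> k; have [? ?] := Foo k; have [? ?] := Goo k.
split; first exact: measurableX.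
rewrite /sigma_finite_product.
by rewrite product_measure1E// lte_mul_pinfty// ge0_fin_numE.
Qed.

HB.instance Definition _ := Measure_isSigmaFinite.Build _ _ _
  sigma_finite_product sigma_finite_productT.

End product_sigma_finite_measure.

(* Lebesgue measure on R^n, by recursion on n: counting measure on the point
   R^0, and the image of the product measure on R * R^n under the
   identification with R^(n+1).  See rV_lebesgue_box below. *)
Section row_vector_lebesgue_measure.
Variable R : realType.

Definition rV_cons n (p : R * 'rV[R]_n) : 'rV[R]_n.+1 :=
  \row_i if unlift ord0 i is Some j then p.2 ord0 j else p.1.

Lemma rV_cons0 n p : @rV_cons n p ord0 ord0 = p.1.
Proof. by rewrite mxE unlift_none. Qed.

Lemma rV_consS n p i : @rV_cons n p ord0 (lift ord0 i) = p.2 ord0 i.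
Proof. by rewrite mxE liftK. Qed.

Lemma measurable_rV_cons n : measurable_fun setT (@rV_cons n).
Proof.
apply: measurable_fun_rVP => i.
have [j ->|->] := unliftP ord0 i.
  rewrite (_ : _ \o _ = @rV_coord R n j \o snd); last first.
    by apply/funext => p; rewrite /= /rV_coord rV_consS.
  by apply: measurableT_comp => //; exact: measurable_rV_coord.
rewrite (_ : _ \o _ = fst) //.
by apply/funext => p; rewrite /= /rV_coord rV_cons0.
Qed.

Section step.
Variables (n : nat) (mu : {sigma_finite_measure set 'rV[R]_n -> \bar R}).

Definition rV_lebesgue_step : set 'rV[R]_n.+1 -> \bar R :=
  pushforward (@lebesgue_measure R \x mu)%E (@rV_cons n).

Let step0 : rV_lebesgue_step set0 = 0%E.
Proof. by rewrite /rV_lebesgue_step /pushforward preimage_set0 measure0. Qed.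

Let mcons := @measurable_rV_cons n.

Let step_ge0 A : (0 <= rV_lebesgue_step A)%E.
Proof. exact: measure_ge0. Qed.

Let step_sigma_additive : semi_sigma_additive rV_lebesgue_step.
Proof. exact: measure_semi_sigma_additive. Qed.

HB.instance Definition _ := isMeasure.Build _ _ _ rV_lebesgue_step
  step0 step_ge0 step_sigma_additive.

Lemma rV_lebesgue_step_box (A : 'I_n.+1 -> set R) :
    (forall i, measurable (A i)) ->
  rV_lebesgue_step [set v : 'rV[R]_n.+1 | forall i, A i (v ord0 i)] =
  (lebesgue_measure (A ord0) *
   mu [set v : 'rV[R]_n | forall i, A (lift ord0 i) (v ord0 i)])%E.
Proof.
move=> mA; have mA0 := mA ord0.
have mAS := @measurable_rV_box R n _ (fun i => mA (lift ord0 i)).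
rewrite -[RHS]product_measure1E// /rV_lebesgue_step /pushforward.
congr (product_measure1 _ _ _).
apply/seteqP; split => p /=.
  move=> Ap; split=> [|i]; first by have := Ap ord0; rewrite rV_cons0.
  by have := Ap (lift ord0 i); rewrite rV_consS.
move=> [Ap1 Ap2] i; have [j ->|->] := unliftP ord0 i.
  by rewrite rV_consS.
by rewrite rV_cons0.
Qed.

Let step_sigma_finite : sigma_finite setT rV_lebesgue_step.
Proof.
have [F TF Foo] := sigma_finite_productT (@lebesgue_measure R) mu.
pose tl (v : 'rV[R]_n.+1) : R * 'rV[R]_n :=
  (v ord0 ord0, \row_i v ord0 (lift ord0 i)).
have tlK p : tl (rV_cons p) = p.
  case: p => a v; rewrite /tl rV_cons0; congr pair.
  by apply/rowP => i; rewrite mxE rV_consS.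
have mtl : measurable_fun setT tl.
  apply/measurable_fun_pair; first exact: measurable_rV_coord.
  apply: measurable_fun_rVP => i.
  rewrite (_ : _ \o _ = @rV_coord R n.+1 (lift ord0 i)).
    exact: measurable_rV_coord.
  by apply/funext => v; rewrite /= /rV_coord mxE.
exists (fun k => tl @^-1` F k).
  by rewrite -preimage_bigcup -TF preimage_setT.
move=> k; have [mF Fk] := Foo k; split.
  by rewrite -[X in measurable X]setTI; exact: mtl.
rewrite /rV_lebesgue_step /pushforward -comp_preimage.
by rewrite (_ : tl \o _ = id)//; apply/funext => p /=.
Qed.

HB.instance Definition _ := Measure_isSigmaFinite.Build _ _ _
  rV_lebesgue_step step_sigma_finite.

End step.

Fixpoint rV_lebesgue n : {sigma_finite_measure set 'rV[R]_n -> \bar R} :=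
  if n is m.+1 then rV_lebesgue_step (rV_lebesgue m) else dirac (0 : 'rV[R]_0).

Lemma rV_lebesgue_box n (A : 'I_n -> set R) :
    (forall i, measurable (A i)) ->
  rV_lebesgue n [set v : 'rV[R]_n | forall i, A i (v ord0 i)] =
  (\prod_(i < n) lebesgue_measure (A i))%E.
Proof.
elim: n => [|n IHn] in A *; move=> mA.
  by rewrite big_ord0 /= diracE mem_set//; case.
rewrite big_ord_recl /= rV_lebesgue_step_box//.
by rewrite (IHn (fun i => A (lift ord0 i))).
Qed.

End row_vector_lebesgue_measure.

Section smooth.
Variables (R : realType) (V : normedModType R).

Definition iter_derive (vs : seq V) (f : V -> R) : V -> R :=
  foldr (fun v g => 'D_v g) f vs.

(* C^infty: the directional derivatives of every order exist and are
   continuous. *)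
Definition smooth (f : V -> R) : Prop := forall vs : seq V,
  continuous (iter_derive vs f) /\
  (forall x v : V, derivable (iter_derive vs f) x v).

Definition supp (f : V -> R) : set V := closure [set x | f x != 0].

(* The functions of C_c^infty(Omega), extended by zero to V. *)
Definition test_function (Omega : set V) (f : V -> R) : Prop :=
  [/\ smooth f, compact (supp f) & supp f `<=` Omega].

End smooth.

(* Points (x, y, t) of H^n.  A notation, so that the library's product topology,
   norm and sigma-algebra are inferred. *)
Notation heisenberg R n := ('rV[R]_n * 'rV[R]_n * R)%type.

Section heisenberg.
Variables (R : realType) (n : nat).
Implicit Types xi : heisenberg R n.

Definition dotv (u v : 'rV[R]_n) : R := \sum_(i < n) u ord0 i * v ord0 i.

Definition heis_mul xi xi' : heisenberg R n :=
  let: (x, y, t) := xi in let: (x', y', t') := xi' in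
  (x + x', y + y', t + t' + 2 * dotv y x' - 2 * dotv x y').

Definition heis_inv xi : heisenberg R n := - xi.

(* The Euclidean norm of z = (x, y). *)
Definition znorm xi : R := Num.sqrt (dotv xi.1.1 xi.1.1 + dotv xi.1.2 xi.1.2).

Definition heis_norm xi : R := (znorm xi ^+ 4 + xi.2 ^+ 2) `^ (4^-1).

Definition heis_dim : nat := (2 * n + 2)%N.

(* dx dy dt; measurableTypeR R is R with the measurable structure that carries
   lebesgue_measure. *)
Definition heis_lebesgue :
    {sigma_finite_measure
       set ('rV[R]_n * 'rV[R]_n * measurableTypeR R)%type -> \bar R} :=
  sigma_finite_product
    (sigma_finite_product (rV_lebesgue R n) (rV_lebesgue R n))
    (@lebesgue_measure R).

Definition heis_x1 (n_gt0 : (0 < n)%N) xi : R := xi.1.1 ord0 (Ordinal n_gt0).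

Definition half_space (n_gt0 : (0 < n)%N) : set (heisenberg R n) :=
  [set xi | 0 < heis_x1 n_gt0 xi].

End heisenberg.

(* Main.v *)
Require Import Defs.
From HB Require Import structures.
From mathcomp Require Import all_boot all_order all_algebra.
From mathcomp Require Import all_classical all_reals all_analysis.
From mathcomp Require Import measurable_realfun.
From mathcomp Require Import ring lra.
Import Order.TTheory GRing.Theory Num.Theory.
Import numFieldNormedType.Exports.

Set Implicit Arguments.
Unset Strict Implicit.
Unset Printing Implicit Defensive.

Local Open Scope classical_set_scope.
Local Open Scope ring_scope.

(** The function is compared with its translates by an amount proportional to
    the distance x_1 from the boundary of the half-space.  For a point k of the
    group put T_k xi = xi o delta_(x_1) k, where delta_r is the dilation
    (x, y, t) |-> (r x, r y, r^2 t) and x_1 is the first coordinate of xi.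
    - For fixed xi with x_1 > 0, the map k |-> T_k xi is a dilation followed by a
      left translation: its Jacobian is x_1^Q, and the distance from xi to T_k xi
      is x_1 d(k).
    - For fixed k, the map xi |-> T_k xi multiplies x_1 by 1 + k_1 and is
      triangular, with Jacobian 1 + k_1.

    Let I be the integral of |f|^p x_1^(-sp) over the half-space, and E(k) that of
    |f - f o T_k|^p x_1^(-sp).  Substituting xi' = T_k xi and exchanging the
    integrals ([gagliardo_energy_ge]) bounds the double integral from below by
    the integral of E(k) d(k)^(-Q-sp) over k, so that only E has to be bounded.
    - If k_1 <= -1, then f o T_k vanishes on the half-space and E(k) = I
      ([shift_energy_far]).
    - If -1 < k_1 < 0, the second fact says that the integral of
      |f o T_k|^p x_1^(-sp) is (1 + k_1)^(sp-1) I.  The triangle inequality in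
      L^p then yields E(k) >= (1 - (1 + k_1)^a)^p I with a = s - 1/p, hence
      E(k) >= (a |k_1| / 2)^p I as soon as a > 0 ([shift_energy_near]).  To
      subtract I one needs I to be finite, and this is what the compactness of
      the support is used for.

    What remains are integrals of explicit kernels: d(k)^(-Q-sp) over k_1 <= -1
    and |k_1|^p d(k)^(-Q-sp) over -1/2 < k_1 < 0.  Under dilations each of them
    behaves as a geometric series, of ratio 2^(-sp) for the first and 2^(-p(1-s))
    for the second.  The ratios approach 1 when s approaches 0 and 1 respectively,
    which produces lower bounds c/s and c/(1-s) ([self_similar_integral]).  Below
    the midpoint s0 of 1/p and 1 the first bound gives the theorem, because 1 - s
    is bounded away from 0 there; from s0 on the second one does, because s and
    a are bounded away from 0. *)

(** * Measurability of elementary expressions *)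

Section measurability.
Context {R : realType} d (T : measurableType d).

Lemma measurable_rV_entry n (i : 'I_n) (f : T -> 'rV[R]_n) :
  measurable_fun setT f -> measurable_fun setT (fun x => f x ord0 i).
Proof. by move=> mf; exact: (measurableT_comp (measurable_rV_coord i) mf). Qed.

Lemma measurable_rVD n (f g : T -> 'rV[R]_n) :
  measurable_fun setT f -> measurable_fun setT g ->
  measurable_fun setT (fun x => f x + g x).
Proof.
move=> mf mg; apply: measurable_fun_rVP => i.
rewrite (_ : _ \o _ = (fun x => f x ord0 i + g x ord0 i)); last first.
  by apply/funext => x; rewrite /= /rV_coord mxE.
by apply: measurable_funD; exact: measurable_rV_entry.
Qed.

Lemma measurable_rVZ n (c : T -> R) (g : T -> 'rV[R]_n) :
  measurable_fun setT c -> measurable_fun setT g ->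
  measurable_fun setT (fun x => c x *: g x).
Proof.
move=> mc mg; apply: measurable_fun_rVP => i.
rewrite (_ : _ \o _ = (fun x => c x * g x ord0 i)); last first.
  by apply/funext => x; rewrite /= /rV_coord mxE.
by apply: measurable_funM => //; exact: measurable_rV_entry.
Qed.

Lemma measurable_dotv n (f g : T -> 'rV[R]_n) :
  measurable_fun setT f -> measurable_fun setT g ->
  measurable_fun setT (fun x => dotv (f x) (g x)).
Proof.
move=> mf mg; apply: measurable_sum => i.
by apply: measurable_funM; exact: measurable_rV_entry.
Qed.

Lemma measurable_bool_natr (b : T -> bool) :
  measurable_fun setT b -> measurable_fun setT (fun x => (b x)%:R : R).
Proof.
move=> mb; rewrite (_ : (fun x => _) = (fun x => if b x then 1 else 0)).
  exact: measurable_fun_ifT.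
by apply/funext => x; case: (b x).
Qed.

Lemma measurable_powRV (g : T -> R) (e : R) :
  measurable_fun setT g -> measurable_fun setT (fun x => (g x `^ e)^-1).
Proof.
move=> mg; under eq_fun do rewrite -powRN.
exact: (measurableT_comp (measurable_powR _)).
Qed.

Lemma measurable_abs_powR (g : T -> R) (e : R) :
  measurable_fun setT g -> measurable_fun setT (fun x => `|g x| `^ e).
Proof.
move=> mg; apply: (measurableT_comp (measurable_powR _)).
exact: measurableT_comp.
Qed.

End measurability.

(** * Maps that rescale a measure *)

(** The constant c is the Jacobian of phi in integrated form, which spares any
    differentiation. *)
Definition rescales d (T : measurableType d) (R : realType)
    (mu : {measure set T -> \bar R}) (c : R) (phi : T -> T) :=
  [/\ 0 <= c, measurable_fun setT phi &
    forall g : T -> \bar R, measurable_fun setT g -> (forall x, 0 <= g x)%E ->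
      (\int[mu]_x g x = c%:E * \int[mu]_x g (phi x))%E].

Lemma eq_rescales d (T : measurableType d) (R : realType)
    (mu : {measure set T -> \bar R}) (c c' : R) (phi psi : T -> T) :
  rescales mu c phi -> c = c' -> phi =1 psi -> rescales mu c' psi.
Proof. by move=> + <- /funext <-. Qed.

Section rescales_product.
Context {R : realType} d1 d2 (T1 : measurableType d1) (T2 : measurableType d2).
Variables (m1 : {sigma_finite_measure set T1 -> \bar R})
          (m2 : {sigma_finite_measure set T2 -> \bar R}).
Local Open Scope ereal_scope.

Lemma integral_sigma_finite_product (g : T1 * T2 -> \bar R) :
  measurable_fun setT g -> (forall x, 0 <= g x) ->
  \int[sigma_finite_product m1 m2]_z g z = \int[m1]_x \int[m2]_y g (x, y).
Proof.
by move=> mg g0; exact: (fubini_tonelli1 (m1 := m1) (m2 := m2) g mg g0).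
Qed.

(** Tonelli: the inner integral is rescaled by the same factor c2 on every
    fibre, the outer one by c1.  Triangular maps are treated by iterating this,
    without determinants. *)
Lemma rescales_skew (c1 c2 : R) (phi1 : T1 -> T1) (phi2 : T1 -> T2 -> T2) :
  rescales m1 c1 phi1 -> (0 <= c2)%R ->
  measurable_fun setT (fun p => phi2 p.1 p.2) ->
  (forall x, rescales m2 c2 (phi2 x)) ->
  rescales (sigma_finite_product m1 m2) (c1 * c2)
    (fun p => (phi1 p.1, phi2 p.1 p.2)).
Proof.
move=> [c10 mphi1 phi1E] c20 mphi2 phi2E.
have mphi : measurable_fun setT (fun p : T1 * T2 => (phi1 p.1, phi2 p.1 p.2)).
  by apply/measurable_fun_pair => //; exact: measurableT_comp.
split=> [||g mg g0]; [exact: mulr_ge0|exact: mphi|].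
have mgphi := measurableT_comp mg mphi.
rewrite !integral_sigma_finite_product//=.
rewrite phi1E/=; first last.
- by move=> x; exact: integral_ge0.
- exact: (measurable_fun_fubini_tonelli_F g mg g0).
rewrite EFinM -muleA; congr (_ * _).
rewrite -ge0_integralZl//=; last 2 first.
- exact: (measurable_fun_fubini_tonelli_F _ mgphi (fun x => g0 _)).
- by move=> x _; exact: integral_ge0.
apply: eq_integral => x _; have [_ _ ->//] := phi2E x.
by apply: measurableT_comp mg _; exact: measurable_pair1.
Qed.

End rescales_product.

Section lebesgue_affine.
Context {R : realType}.
Notation leb := (@lebesgue_measure R).

Lemma measurable_affine (c b : R) :
  measurable_fun setT
    (fun x : measurableTypeR R => c * x + b : measurableTypeR R).
Proof. by apply: measurable_funD => //; exact: mulrl_measurable. Qed.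

Local Open Scope ereal_scope.

Let affine (c b : R) (x : measurableTypeR R) : measurableTypeR R :=
  (c * x + b)%R.

(* Unification cannot recover the measurability proof on which the measure
   structure of a push-forward depends, so it is supplied explicitly. *)
Let measure_pushforward_affine (c b : R) :=
  measure_function_pushforward__canonical__measure_function_Measure
    leb (measurable_affine c b : measurable_fun setT (affine c b)).

(** By uniqueness of Lebesgue measure it suffices to compare the two sides on
    half-open intervals. *)
Lemma lebesgue_measure_affine (c : {nonneg R}) (b : R)
    (A : set (measurableTypeR R)) :
  (0 < c%:num)%R -> measurable A ->
  leb A = mscale c (measure_pushforward_affine c%:num b) A.
Proof.
move=> c0; move: A; apply: lebesgue_measure_unique.
move=> X /ocitvP[->|[[u v] /= uv ->]].
  by rewrite !measure0.
rewrite /mscale /= /pushforward /affine.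
rewrite (_ : _ @^-1` _ =
    `]((u - b) / c%:num)%R, ((v - b) / c%:num)%R]%classic); last first.
  apply/seteqP; split => x /=;
    by rewrite !in_itv/= ltr_pdivrMr// ler_pdivlMr// ltrBlDr lerBrDr mulrC.
rewrite !lebesgue_measure_itv/= !lte_fin uv ltr_pM2r ?invr_gt0// ltrD2r uv.
rewrite -!EFinB -EFinM; congr EFin.
by rewrite -mulrBl mulrCA mulfV ?gt_eqF// mulr1 opprB addrA subrK.
Qed.

Lemma integral_lebesgue_affine (c b : R) (g : R -> \bar R) : (0 < c)%R ->
  measurable_fun setT g -> (forall x, 0 <= g x) ->
  \int[leb]_x g x = c%:E * \int[leb]_x g (c * x + b)%R.
Proof.
move=> c0 mg g0; pose c' : {nonneg R} := NngNum (ltW c0).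
transitivity (\int[mscale c' (measure_pushforward_affine c b)]_x g x).
  apply: eq_measure_integral => //= A mA _.
  by rewrite (@lebesgue_measure_affine c' b).
rewrite ge0_integral_mscale//.
by rewrite ge0_integral_pushforward//; exact: measurable_affine.
Qed.

End lebesgue_affine.

Section rescales_rV.
Context {R : realType}.
Local Open Scope ereal_scope.
Notation leb := (@lebesgue_measure R).

Lemma rescales_lebesgue (c b : R) : (0 < c)%R ->
  rescales leb c (fun x => c * x + b)%R.
Proof.
move=> c0; split; [exact: ltW|exact: measurable_affine|] => g mg g0.
exact: integral_lebesgue_affine.
Qed.

Lemma integral_rV_lebesgueS n (g : 'rV[R]_n.+1 -> \bar R) :
  measurable_fun setT g -> (forall x, 0 <= g x) ->
  \int[rV_lebesgue R n.+1]_x g x =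
  \int[sigma_finite_product leb (rV_lebesgue R n)]_p g (rV_cons p).
Proof.
move=> mg g0 /=; rewrite /rV_lebesgue_step ge0_integral_pushforward//.
exact: measurable_rV_cons.
Qed.

(** Lebesgue measure on row vectors is the image of a product measure under
    [rV_cons], so rescaling can be checked on the product. *)
Lemma rescales_rV_cons n (c : R) (psi : 'rV[R]_n.+1 -> 'rV[R]_n.+1)
    (phi : measurableTypeR R * 'rV[R]_n -> measurableTypeR R * 'rV[R]_n) :
  measurable_fun setT psi ->
  rescales (sigma_finite_product leb (rV_lebesgue R n)) c phi ->
  (forall p, psi (rV_cons p) = rV_cons (phi p)) ->
  rescales (rV_lebesgue R n.+1) c psi.
Proof.
move=> mpsi [c0 mphi phiE] psiE; split=> // g mg g0.
rewrite integral_rV_lebesgueS// phiE//; last first.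
  by apply: measurableT_comp mg _; exact: measurable_rV_cons.
rewrite integral_rV_lebesgueS//; last exact: measurableT_comp.
by under [in RHS]eq_integral do rewrite psiE.
Qed.

Lemma rV_cons_affine n (c : R) (b : 'rV[R]_n.+1) (p : R * 'rV[R]_n) :
  (c *: rV_cons p + b =
   rV_cons (c * p.1 + b ord0 ord0, c *: p.2 + \row_j b ord0 (lift ord0 j)))%R.
Proof.
apply/rowP => i; have [j ->|->] := unliftP ord0 i.
  by rewrite rV_consS !mxE liftK/= ?mxE.
by rewrite rV_cons0 !mxE unlift_none.
Qed.

Lemma rescales_rV_affine n (c : R) (b : 'rV[R]_n) : (0 < c)%R ->
  rescales (rV_lebesgue R n) (c ^+ n) (fun x => c *: x + b)%R.
Proof.
move=> c0; have c0' := ltW c0.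
elim: n b => [|n IH] b.
  split; first exact: exprn_ge0.
    by apply: measurable_rVD => //; exact: measurable_rVZ.
  move=> g mg g0; rewrite expr0 mul1e; apply: eq_integral => x _; congr g.
  by apply/rowP; case.
rewrite exprS.
pose b' : 'rV[R]_n := (\row_j b ord0 (lift ord0 j))%R.
have := rescales_skew (rescales_lebesgue (b ord0 ord0) c0) (exprn_ge0 n c0')
  (phi2 := fun (_ : measurableTypeR R) (v : 'rV[R]_n) => (c *: v + b')%R)
  _ (fun _ => IH b').
move=> H; apply: rescales_rV_cons (H _) (@rV_cons_affine _ _ _).
- by apply: measurable_rVD => //; exact: measurable_rVZ.
- by apply: measurable_rVD => //; exact: measurable_rVZ.
Qed.

(** The first coordinate is multiplied by 1 + a_1, and the others are translated
    by an amount that depends on the first one only. *)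
Lemma rescales_rV_shear n (a : 'rV[R]_n.+1) : (0 < 1 + a ord0 ord0)%R ->
  rescales (rV_lebesgue R n.+1) (1 + a ord0 ord0)
    (fun x => x + x ord0 ord0 *: a)%R.
Proof.
move=> a0; pose a' : 'rV[R]_n := (\row_j a ord0 (lift ord0 j))%R.
have T (x : measurableTypeR R) :
    rescales (rV_lebesgue R n) 1 (fun v => v + x *: a')%R.
  have := rescales_rV_affine (x *: a') ltr01; rewrite expr1n.
  by under eq_fun do rewrite scale1r.
have := rescales_skew (rescales_lebesgue 0 a0) ler01
  (phi2 := fun (x : measurableTypeR R) (v : 'rV[R]_n) => (v + x *: a')%R) _ T.
rewrite mulr1 => H; apply: rescales_rV_cons (H _) _.
- apply: measurable_rVD => //; apply: measurable_rVZ => //.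
  exact: measurable_rV_coord.
- by apply: measurable_rVD => //; exact: measurable_rVZ.
move=> p; apply/rowP => i; have [j ->|->] := unliftP ord0 i.
  by rewrite rV_consS !mxE liftK unlift_none /= ?mxE.
by rewrite rV_cons0 !mxE unlift_none/=; ring.
Qed.

End rescales_rV.

(** * Dilations and translations of the Heisenberg group *)

(** The points of the group with the sigma-algebra of [heis_lebesgue]. *)
Notation heisM R n := ('rV[R]_n * 'rV[R]_n * measurableTypeR R)%type.

Definition dilation (R : realType) n (r : R) (xi : heisenberg R n) :
    heisenberg R n :=
  (r *: xi.1.1, r *: xi.1.2, r ^+ 2 * xi.2).

Section heis_algebra.
Context {R : realType} {n : nat}.
Implicit Types (xi k : heisenberg R n).

Lemma dotvDr (u v w : 'rV[R]_n) : dotv u (v + w) = dotv u v + dotv u w.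
Proof.
by rewrite -big_split; apply: eq_bigr => i _; rewrite mxE mulrDr.
Qed.

Lemma dotvNl (u v : 'rV[R]_n) : dotv (- u) v = - dotv u v.
Proof.
by rewrite /dotv -sumrN; apply: eq_bigr => i _; rewrite mxE mulNr.
Qed.

Lemma dotvC (u v : 'rV[R]_n) : dotv u v = dotv v u.
Proof. by apply: eq_bigr => i _; rewrite mulrC. Qed.

Lemma dotvZZ (r : R) (u v : 'rV[R]_n) : dotv (r *: u) (r *: v) = r ^+ 2 * dotv u v.
Proof.
rewrite /dotv mulr_sumr; apply: eq_bigr => i _; rewrite !mxE; ring.
Qed.

Lemma dotv_ge0 (u : 'rV[R]_n) : 0 <= dotv u u.
Proof. by apply: sumr_ge0 => i _; rewrite -expr2 sqr_ge0. Qed.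

Lemma heis_mulKV xi k : heis_mul (heis_inv xi) (heis_mul xi k) = k.
Proof.
case: xi k => -[x y] t [[a b] c]; rewrite /heis_mul /heis_inv /=.
congr (_, _, _); rewrite ?addKr//.
rewrite !dotvNl !dotvDr (dotvC y x); ring.
Qed.

Lemma heis_norm_dilation (r : R) k : 0 <= r ->
  heis_norm (dilation r k) = r * heis_norm k.
Proof.
move=> r0; rewrite /heis_norm /znorm /= !dotvZZ -mulrDr sqrtrM ?sqr_ge0//.
rewrite sqrtr_sqr ger0_norm// !exprMn -exprD -mulrDr powRM ?exprn_ge0//; last first.
  by rewrite addr_ge0 ?sqr_ge0// exprn_ge0// sqrtr_ge0.
by congr (_ * _); rewrite -powR_mulrn// -powRrM mulfV// powRr1.
Qed.

Lemma heis_x1_dilation (n_gt0 : (0 < n)%N) (r : R) k :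
  heis_x1 n_gt0 (dilation r k) = r * heis_x1 n_gt0 k.
Proof. by rewrite /heis_x1 /= mxE. Qed.

Lemma heis_x1_mul (n_gt0 : (0 < n)%N) xi k :
  heis_x1 n_gt0 (heis_mul xi k) = heis_x1 n_gt0 xi + heis_x1 n_gt0 k.
Proof. by case: xi k => -[x y] t [[a b] c]; rewrite /heis_x1 /= mxE. Qed.

Lemma heis_mul0 k : heis_mul 0 k = k.
Proof.
case: k => -[a b] c; rewrite /heis_mul /=; congr (_, _, _); rewrite ?add0r//.
by rewrite /dotv !big1 ?mulr0 ?addr0 ?subr0// => i _; rewrite mxE mul0r.
Qed.

Lemma heis_norm_ge0 xi : 0 <= heis_norm xi.
Proof. exact: powR_ge0. Qed.

End heis_algebra.

Section heis_measurable.
Context {R : realType} {n : nat} d (T : measurableType d).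

Lemma measurable_dilation (r : T -> R) (f : T -> heisM R n) :
  measurable_fun setT r -> measurable_fun setT f ->
  measurable_fun setT (fun x => dilation (r x) (f x) : heisM R n).
Proof.
move=> mr mf.
have m1 := measurableT_comp measurable_fst mf.
have m11 := measurableT_comp measurable_fst m1.
have m12 := measurableT_comp measurable_snd m1.
have m2 := measurableT_comp measurable_snd mf.
apply/measurable_fun_pair; first apply/measurable_fun_pair.
- exact: measurable_rVZ.
- exact: measurable_rVZ.
- by apply: measurable_funM => //; exact: measurable_funX.
Qed.

Lemma measurable_heis_mul (f g : T -> heisM R n) :
  measurable_fun setT f -> measurable_fun setT g ->
  measurable_fun setT (fun x => heis_mul (f x) (g x) : heisM R n).
Proof.
move=> mf mg.
have m1 := measurableT_comp measurable_fst mf.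
have m11 := measurableT_comp measurable_fst m1.
have m12 := measurableT_comp measurable_snd m1.
have m2 := measurableT_comp measurable_snd mf.
have p1 := measurableT_comp measurable_fst mg.
have p11 := measurableT_comp measurable_fst p1.
have p12 := measurableT_comp measurable_snd p1.
have p2 := measurableT_comp measurable_snd mg.
rewrite (_ : (fun x => _) = fun x =>
  ((f x).1.1 + (g x).1.1, (f x).1.2 + (g x).1.2, (f x).2 + (g x).2 +
   2 * dotv (f x).1.2 (g x).1.1 - 2 * dotv (f x).1.1 (g x).1.2)); last first.
  by apply/funext => x; case: (f x) => -[? ?] ?; case: (g x) => -[? ?] ?.
apply/measurable_fun_pair; first apply/measurable_fun_pair.
- exact: measurable_rVD.
- exact: measurable_rVD.
- apply: measurable_funB; last by apply: measurable_funM => //; exact: measurable_dotv.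
  by apply: measurable_funD; [exact: measurable_funD|
    apply: measurable_funM => //; exact: measurable_dotv].
Qed.

Lemma measurable_heis_x1 (n_gt0 : (0 < n)%N) (f : T -> heisM R n) :
  measurable_fun setT f -> measurable_fun setT (fun x => heis_x1 n_gt0 (f x)).
Proof.
move=> mf; apply: measurable_rV_entry.
exact: (measurableT_comp measurable_fst (measurableT_comp measurable_fst mf)).
Qed.

Lemma measurable_heis_norm (f : T -> heisM R n) :
  measurable_fun setT f -> measurable_fun setT (fun x => heis_norm (f x)).
Proof.
move=> mf.
have m1 := measurableT_comp measurable_fst mf.
have m11 := measurableT_comp measurable_fst m1.
have m12 := measurableT_comp measurable_snd m1.
have m2 := measurableT_comp measurable_snd mf.
apply: (measurableT_comp (measurable_powR _)).
apply: measurable_funD; apply: measurable_funX => //.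
have -> : (fun x => znorm (f x)) = (fun x =>
    (dotv (f x).1.1 (f x).1.1 + dotv (f x).1.2 (f x).1.2) `^ 2^-1).
  apply/funext => x; rewrite powR12_sqrt//.
  by apply: addr_ge0; apply: sumr_ge0 => i _; rewrite -expr2 sqr_ge0.
apply: (measurableT_comp (measurable_powR _)).
by apply: measurable_funD; exact: measurable_dotv.
Qed.

End heis_measurable.

Section heis_rescaling.
Context {R : realType} {n : nat}.

(** The coordinates x and y are scaled by r, then t is scaled by r^2 and
    translated by a function of x and y: the factor is r^(n + n + 2). *)
Lemma rescales_left_dilation (xi : heisenberg R n) (r : R) : 0 < r ->
  rescales (heis_lebesgue R n) (r ^+ heis_dim n)
    (fun k => heis_mul xi (dilation r k)).
Proof.
case: xi => -[x y] t r0; have r0' := ltW r0.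
pose phi2 (a b : 'rV[R]_n) := r *: b + y.
pose phi3 (p : 'rV[R]_n * 'rV[R]_n) (c : measurableTypeR R) : measurableTypeR R :=
  r ^+ 2 * c + (t + 2 * dotv y (r *: p.1) - 2 * dotv x (r *: p.2)).
have mphi2 : measurable_fun setT (fun p => phi2 p.1 p.2).
  by apply: measurable_rVD => //; exact: measurable_rVZ.
have mphi3 : measurable_fun setT (fun p => phi3 p.1 p.2).
  apply: measurable_funD; first exact: measurable_funM.
  apply: measurable_funB; last first.
    apply: measurable_funM => //; apply: measurable_dotv => //.
    apply: measurable_rVZ => //; exact: (measurableT_comp measurable_snd measurable_fst).
  apply: measurable_funD => //.
  apply: measurable_funM => //; apply: measurable_dotv => //.
  apply: measurable_rVZ => //; exact: (measurableT_comp measurable_fst measurable_fst).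
have S12 := rescales_skew (rescales_rV_affine x r0) (exprn_ge0 n r0') mphi2
  (fun _ => rescales_rV_affine y r0).
have S3 := rescales_skew S12 (exprn_ge0 2 r0') mphi3
  (fun _ => rescales_lebesgue _ (exprn_gt0 2 r0)).
apply: (eq_rescales S3).
  by rewrite -!exprD /heis_dim; congr (_ ^+ _); rewrite mulSn mul1n.
move=> [[a b] c] /=; rewrite /phi2 /phi3 /=; congr (_, _, _).
- by rewrite addrC.
- by rewrite addrC.
- by ring.
Qed.

(** Only x_1 is scaled: the other x_j and y are translated by multiples of x_1,
    and t by a function of x and y. *)
Lemma rescales_moving_shear (n_gt0 : (0 < n)%N) (k : heisenberg R n) :
  0 < 1 + heis_x1 n_gt0 k ->
  rescales (heis_lebesgue R n) (1 + heis_x1 n_gt0 k)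
    (fun xi => heis_mul xi (dilation (heis_x1 n_gt0 xi) k)).
Proof.
case: n n_gt0 k => // m m_gt0 [[a b] c]; rewrite /heis_x1 /=.
have -> : Ordinal m_gt0 = ord0 by exact: val_inj.
move=> a0.
pose phi2 (x y : 'rV[R]_m.+1) := 1 *: y + x ord0 ord0 *: b.
pose phi3 (p : 'rV[R]_m.+1 * 'rV[R]_m.+1) (t : measurableTypeR R) : measurableTypeR R :=
  1 * t + (p.1 ord0 ord0 ^+ 2 * c + 2 * dotv p.2 (p.1 ord0 ord0 *: a)
   - 2 * dotv p.1 (p.1 ord0 ord0 *: b)).
have mphi2 : measurable_fun setT (fun p => phi2 p.1 p.2).
  apply: measurable_rVD; first exact: measurable_rVZ.
  by apply: measurable_rVZ => //; exact: measurable_rV_entry.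
have mphi3 : measurable_fun setT (fun p => phi3 p.1 p.2).
  have m11 : measurable_fun setT
      (fun p : 'rV[R]_m.+1 * 'rV[R]_m.+1 * measurableTypeR R => p.1.1).
    exact: (measurableT_comp measurable_fst measurable_fst).
  have m12 : measurable_fun setT
      (fun p : 'rV[R]_m.+1 * 'rV[R]_m.+1 * measurableTypeR R => p.1.2).
    exact: (measurableT_comp measurable_snd measurable_fst).
  have m0 := measurable_rV_entry ord0 m11.
  apply: measurable_funD; first exact: measurable_funM.
  apply: measurable_funB; last first.
    apply: measurable_funM => //; apply: measurable_dotv => //.
    exact: measurable_rVZ.
  apply: measurable_funD => //.
    by apply: measurable_funM => //; exact: measurable_funX.
  apply: measurable_funM => //; apply: measurable_dotv => //.
  exact: measurable_rVZ.
have S2 x : rescales (rV_lebesgue R m.+1) 1 (phi2 x).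
  by have := rescales_rV_affine (x ord0 ord0 *: b) (@ltr01 R); rewrite expr1n.
have S12 := rescales_skew (rescales_rV_shear a0) ler01 mphi2 S2.
have S3 := rescales_skew S12 ler01 mphi3 (fun _ => rescales_lebesgue _ ltr01).
apply: (eq_rescales S3); first by rewrite !mulr1.
move=> [[x y] t] /=; rewrite /phi2 /phi3 scale1r /=; congr (_, _, _).
by rewrite mul1r !addrA.
Qed.

End heis_rescaling.

(** * Elementary inequalities *)

Section real_inequalities.
Context {R : realType}.
Implicit Types (p u v th : R).

Lemma ler_inv u v : 0 < u -> u <= v -> v^-1 <= u^-1.
Proof. by move=> u0 uv; rewrite lef_pV2// posrE// (lt_le_trans u0). Qed.

(** Convexity of the power, for u = (1 - th) (u - v) / (1 - th) + th v / th.
    With a suitable th, the integrated inequality is as sharp as the triangle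
    inequality in L^p. *)
Lemma powR_triangle p th u v : 1 <= p -> 0 < th < 1 ->
  `|u| `^ p <= (1 - th) `^ (1 - p) * `|u - v| `^ p + th `^ (1 - p) * `|v| `^ p.
Proof.
move=> p1 /andP[th0 th1]; have p0 : 0 <= p by lra.
have th1' : 0 < 1 - th by lra.
have E (z w : R) : 0 < z -> z `^ (1 - p) * `|w| `^ p = z * (`|w| / z) `^ p.
  move=> z0; rewrite powRM// ?invr_ge0 ?ltW//.
  rewrite -powR_inv1 ?ltW// -powRrM mulN1r powRD ?(gt_eqF z0) ?implybT//.
  by rewrite powRr1 ?ltW//; ring.
rewrite !E//.
have := @convex_powR R p p1 (Itv01 (ltW th0) (ltW th1))
  (`|v| / th) (`|u - v| / (1 - th)).
rewrite !inE /= !in_itv /= !andbT !divr_ge0 ?(ltW th0) ?(ltW th1')//.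
move=> /(_ isT isT).
rewrite !convRE /= => H; rewrite addrC; apply: le_trans H.
have E2 : `|u| <= th * (`|v| / th) + (1 - th) * (`|u - v| / (1 - th)).
  rewrite mulrCA divff ?gt_eqF// mulrCA divff ?gt_eqF// !mulr1 addrC.
  by rewrite -{1}(subrK v u) ler_normD.
by apply: ge0_ler_powR; rewrite ?nnegrE// (le_trans _ E2).
Qed.

(** Indeed (1 - v)^a <= exp (- a v) <= 1 / (1 + a v), and 1 + a v <= 2. *)
Lemma one_minus_powR_ge (a v : R) : 0 <= a <= 1 -> 0 <= v < 1 ->
  a * v / 2 <= 1 - (1 - v) `^ a.
Proof.
move=> /andP[a0 a1] /andP[v0 v1].
have w0 : 0 < 1 - v by lra.
rewrite /powR gt_eqF//.
have l : ln (1 - v) <= - v by apply: le_ln1Dx; lra.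
have : expR (a * ln (1 - v)) <= expR (- (a * v)).
  by rewrite ler_expR -mulrN ler_wpM2l.
rewrite expRN => H.
have av : 0 <= a * v <= 1 by apply/andP; split; [exact: mulr_ge0|nra].
have : (expR (a * v))^-1 <= (1 + a * v)^-1.
  by rewrite lef_pV2 ?posrE ?expR_gt0// ?expR_ge1Dx//; lra.
have : (1 + a * v)^-1 <= 1 - a * v / 2.
  rewrite -div1r ler_pdivrMr; last by lra.
  nra.
lra.
Qed.

(** Indeed exp (- x) >= 1 - x, and ln 2 <= 1. *)
Lemma one_minus_powR2N_le (sg : R) : 0 <= sg -> 1 - 2 `^ (- sg) <= sg.
Proof.
move=> sg0; rewrite /powR gt_eqF//.
have := expR_ge1Dx (- sg * ln 2).
have : ln (1 + 1 : R) <= 1 by apply: le_ln1Dx; lra.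
rewrite (_ : 1 + 1 = 2) // => l2 H.
have : sg * ln 2 <= sg by rewrite ler_piMr.
lra.
Qed.

End real_inequalities.

(** * Continuous functions are measurable *)

Section continuous_measurable.
Context {R : realType}.

(** Every preimage is a countable union of fibres of i, whatever g is. *)
Lemma measurable_countable_factor d (T : measurableType d) d' (U : measurableType d')
    (Z : countType) (i : T -> Z) (g : Z -> U) :
  (forall z, measurable (i @^-1` [set z])) -> measurable_fun setT (g \o i).
Proof.
move=> mi _ Y mY; rewrite setTI.
rewrite (_ : _ @^-1` _ = \bigcup_(z in [set: Z])
    (i @^-1` [set z] `&` [set x | Y (g z)])); last first.
  apply/seteqP; split => x /=; first by move=> Yx; exists (i x).
  by move=> [z _ [/= <-]].
apply: countable_bigcupT_measurable => [|z]; first exact: countableP.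
have [Yz|nYz] := pselect (Y (g z)).
  by rewrite (_ : [set x | _] = setT) ?setIT//; apply/seteqP; split.
by rewrite (_ : [set x | _] = set0) ?setI0//; apply/seteqP; split.
Qed.

Definition grid_index (m : nat) (x : R) : int := Num.floor (x * m.+1%:R).
Definition grid_point (m : nat) (z : int) : R := z%:~R / m.+1%:R.

Lemma measurable_grid_index m (z : int) :
  measurable (grid_index m @^-1` [set z] : set (measurableTypeR R)).
Proof.
have m0 : 0 < m.+1%:R :> R by rewrite ltr0n.
rewrite (_ : _ @^-1` _ = `[z%:~R / m.+1%:R, (z + 1)%:~R / m.+1%:R[%classic).
  exact: measurable_itv.
apply/seteqP; split => x /=; rewrite in_itv/= ler_pdivrMr// ltr_pdivlMr//.
  by move=> <-; exact: floor_itv.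
by move=> H; exact: floor_def.
Qed.

Lemma dist_grid_point m (x : R) :
  `|x - grid_point m (grid_index m x)| <= m.+1%:R^-1.
Proof.
have m0 : 0 < m.+1%:R :> R by rewrite ltr0n.
have /andP[] := floor_itv (x * m.+1%:R).
rewrite /grid_point /grid_index intrD => H1 H2.
rewrite ger0_norm; last by rewrite subr_ge0 ler_pdivrMr.
by rewrite lerBlDr -[X in X + _]mul1r -mulrDl ler_pdivlMr// addrC ltW.
Qed.

Lemma mx_norm_le k (v : 'rV[R]_k) (e : R) : 0 <= e ->
  (forall i, `|v ord0 i| <= e) -> `|v| <= e.
Proof.
move=> e0 ve; rewrite /Num.norm/= mx_normrE; apply/bigmax_leP; split => //= -[i j] _ /=.
by rewrite (ord1 i).
Qed.

Lemma le_mx_norm k (v : 'rV[R]_k) i : `|v ord0 i| <= `|v|.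
Proof.
rewrite [leRHS]/Num.norm/= mx_normrE.
exact: (le_bigmax _ (fun ij => `|v ij.1 ij.2|) (ord0, i)).
Qed.

Variable n : nat.

(** The sigma-algebra is generated by the coordinates, not by the open sets.
    Rounding all coordinates down to the grid of mesh 1 / (m + 1) factors through
    a countable set, and by continuity the values of f at the rounded points
    converge to f. *)
Lemma continuous_measurable_heis (f : heisenberg R n -> R) :
  continuous f -> measurable_fun setT (f : heisM R n -> R).
Proof.
move=> cf.
pose Z := ('rV[int]_n * 'rV[int]_n * int)%type.
pose ix m (xi : heisM R n) : Z :=
  (map_mx (grid_index m) xi.1.1, map_mx (grid_index m) xi.1.2, grid_index m xi.2).
pose pt m (z : Z) : heisenberg R n :=
  (map_mx (grid_point m) z.1.1, map_mx (grid_point m) z.1.2, grid_point m z.2).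
have mrV (m : nat) (z : 'rV[int]_n) :
    measurable [set v : 'rV[R]_n | map_mx (grid_index m) v = z].
  rewrite (_ : mkset _ = [set v : 'rV[R]_n |
      forall i, (grid_index m @^-1` [set z ord0 i]) (v ord0 i)]).
    apply: (@measurable_rV_box _ _ (fun i => grid_index m @^-1` [set z ord0 i])) => i.
    exact: measurable_grid_index.
  apply/seteqP; split => v /=; first by move=> <- i; rewrite mxE.
  by move=> H; apply/rowP => i; rewrite mxE.
apply: (@measurable_fun_cvg _ _ _ _ (fun m => (f \o pt m) \o ix m)).
  move=> m; apply: measurable_countable_factor => -[[a b] c].
  rewrite (_ : _ @^-1` _ = ([set v | map_mx (grid_index m) v = a] `*`
    [set v | map_mx (grid_index m) v = b]) `*` (grid_index m @^-1` [set c])).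
    by apply: measurableX; [exact: measurableX|exact: measurable_grid_index].
  by apply/seteqP; split => -[[x y] t] /=; [case=> -> -> ->|case=> -[<- <-] <-].
move=> xi _.
suff H : (fun m => pt m (ix m xi)) @ \oo --> (xi : heisenberg R n).
  exact: (cvg_comp _ _ H (cf xi)).
apply/cvgrPdist_le => e e0.
near=> m; apply: (@le_trans _ _ m.+1%:R^-1); last first.
  by apply: ltW; near: m; exact: near_infty_natSinv_lt (PosNum e0).
have m0 : 0 <= m.+1%:R^-1 :> R by rewrite invr_ge0.
rewrite /= !prod_normE /= !ge_max; apply/andP; split; first (apply/andP; split).
- by apply: mx_norm_le => // i; rewrite !mxE; exact: dist_grid_point.
- by apply: mx_norm_le => // i; rewrite !mxE; exact: dist_grid_point.
- exact: dist_grid_point.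
Unshelve. all: by end_near. Qed.

End continuous_measurable.

(** * Lower bounds for integrals of the kernel *)

Section kernel.
Context {R : realType} {n : nat}.
Notation H := (heisM R n).
Notation mu := (heis_lebesgue R n).

(** Let J and W be the integrals of h and w.  The substitution k |-> delta_r k
    gives J >= 2^(-sg) (J + W).  If J is finite, this reads
    (1 - 2^(-sg)) J >= 2^(-sg) W, and 1 - 2^(-sg) <= sg. *)
Lemma self_similar_integral (h w : H -> R) (r sg : R) : 0 < r -> 0 < sg ->
  measurable_fun setT h -> measurable_fun setT w ->
  (forall k, 0 <= h k) -> (forall k, 0 <= w k) ->
  (forall k, 2 `^ (- sg) * (h k + w k) <= r ^+ heis_dim n * h (dilation r k)) ->
  ((2 `^ (- sg) / sg)%:E * \int[mu]_k (w k)%:E <= \int[mu]_k (h k)%:E)%E.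
Proof.
move=> r0 sg0 mh mw h0 w0 hw.
have l0 : 0 < 2 `^ (- sg) :> R by rewrite powR_gt0.
have J0 : (0 <= \int[mu]_k (h k)%:E)%E by apply: integral_ge0 => k _; rewrite lee_fin.
have W0 : (0 <= \int[mu]_k (w k)%:E)%E by apply: integral_ge0 => k _; rewrite lee_fin.
have : ((2 `^ (- sg))%:E * (\int[mu]_k (h k)%:E + \int[mu]_k (w k)%:E)
    <= \int[mu]_k (h k)%:E)%E.
  have [_ mphi E] := rescales_left_dilation (0 : heisenberg R n) r0.
  rewrite [leRHS]E; last 2 first.
  - exact/measurable_EFinP.
  - by move=> x; rewrite lee_fin.
  rewrite -ge0_integralZl//; last 3 first.
  - by apply/measurable_EFinP; exact: (measurableT_comp mh mphi).
  - by move=> x _; rewrite lee_fin.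
  - by rewrite lee_fin exprn_ge0// ltW.
  rewrite -ge0_integralD//; last 4 first.
  - by move=> x _; rewrite lee_fin.
  - exact/measurable_EFinP.
  - by move=> x _; rewrite lee_fin.
  - exact/measurable_EFinP.
  rewrite -ge0_integralZl//; last 2 first.
  - by apply: emeasurable_funD; exact/measurable_EFinP.
  - by move=> x _; rewrite -EFinD lee_fin addr_ge0.
  apply: ge0_le_integral => //.
  - by move=> x _; rewrite -EFinD -EFinM lee_fin mulr_ge0 ?addr_ge0// ltW.
  - by apply: measurable_funeM; apply: emeasurable_funD; exact/measurable_EFinP.
  - apply: measurable_funeM; apply/measurable_EFinP.
    exact: (measurableT_comp mh mphi).
  - by move=> k _; rewrite -EFinD -!EFinM lee_fin heis_mul0.
move: J0 W0.
case: (\int[mu]_k (h k)%:E)%E => [j| |] //; last by move=> *; rewrite leey.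
case: (\int[mu]_k (w k)%:E)%E => [v| |] //=.
  rewrite !lee_fin => j0 v0 H1.
  have := one_minus_powR2N_le (ltW sg0) => H2.
  rewrite -mulrA mulrCA mulrC ler_pdivrMr//.
  nra.
by move=> _ _; rewrite addey// gt0_muley ?lte_fin//.
Qed.

Definition heis_cube (A : set R) : set H :=
  ([set v : 'rV[R]_n | forall i, A (v ord0 i)] `*`
   [set v : 'rV[R]_n | forall i, A (v ord0 i)]) `*` A.

Lemma measurable_heis_cube (A : set R) :
  measurable A -> measurable (heis_cube A).
Proof.
move=> mA; apply: measurableX => //.
by apply: measurableX; exact: (@measurable_rV_box _ _ (fun=> A)).
Qed.

Lemma heis_lebesgue_cube (A : set R) (l : R) : measurable A ->
  lebesgue_measure A = l%:E -> mu (heis_cube A) = (l ^+ (n + n + 1))%:E.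
Proof.
move=> mA lA; have mV := @measurable_rV_box _ n (fun=> A) (fun=> mA).
pose V := [set v : 'rV[R]_n | forall i, A (v ord0 i)].
have lV : rV_lebesgue R n V = (l ^+ n)%:E.
  rewrite (rV_lebesgue_box (A := fun=> A))//.
  by under eq_bigr do rewrite lA; rewrite prodEFin prodr_const card_ord.
transitivity (rV_lebesgue R n V * rV_lebesgue R n V * lebesgue_measure A)%E.
  rewrite [LHS]product_measure1E//; last exact: measurableX.
  by congr (_ * _)%E; exact: product_measure1E.
by rewrite lA lV -!EFinM; congr EFin; rewrite !exprD expr1.
Qed.

Definition cube_side : set R := `]-1, - 2^-1]%classic.

(** A piece of the shell -1 < x_1 <= -1/2.  The dilation by 2 moves the shell into
    the region x_1 <= -1, and the dilation by 1/2 moves it into the region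
    -1/2 < x_1 < 0.  On the piece the homogeneous norm is bounded, and it does not
    vanish because t does not. *)
Definition test_cube : set H := heis_cube cube_side.

Lemma measurable_test_cube : measurable test_cube.
Proof. by apply: measurable_heis_cube; exact: measurable_itv. Qed.

Lemma heis_lebesgue_test_cube : mu test_cube = (2^-1 ^+ (n + n + 1))%:E.
Proof.
apply: heis_lebesgue_cube; first exact: measurable_itv.
rewrite lebesgue_measure_itv/= lte_fin ifT; last by lra.
by rewrite -EFinB; congr EFin; lra.
Qed.

(** On [test_cube] one has |z|^2 <= 2 n and t^2 <= 1. *)
Definition cube_radius : R := ((4 * n%:R ^+ 2 + 1) `^ 4^-1).

Lemma cube_radius_ge1 : 1 <= cube_radius.
Proof.
suff : 1 `^ 4^-1 <= cube_radius by rewrite powR1.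
have X1 : 1 <= 4 * n%:R ^+ 2 + 1 :> R by rewrite lerDr mulr_ge0// sqr_ge0.
by apply: ge0_ler_powR; rewrite ?nnegrE// (le_trans _ X1).
Qed.

Lemma heis_norm_test_cube (k : heisenberg R n) :
  test_cube k -> 0 < heis_norm k <= cube_radius.
Proof.
case: k => -[a b] c [[/= Ja Jb] Jc].
have sq (x : R) : cube_side x -> x * x <= 1.
  by rewrite /cube_side /= in_itv /= => /andP[]; nra.
have dB (v : 'rV[R]_n) : (forall i, cube_side (v ord0 i)) -> dotv v v <= n%:R.
  move=> Jv; apply: (@le_trans _ _ (\sum_(i < n) 1)).
    by apply: ler_sum => i _; exact: sq.
  by rewrite sumr_const card_ord.
have Z4 : znorm (a, b, c) ^+ 4 <= 4 * n%:R ^+ 2.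
  rewrite (_ : 4%N = (2 * 2)%N)// exprM sqr_sqrtr ?addr_ge0 ?dotv_ge0//=.
  have := dB _ Ja; have := dB _ Jb; have := dotv_ge0 a; have := dotv_ge0 b.
  nra.
have Z0 : 0 <= znorm (a, b, c) ^+ 4 by rewrite exprn_ge0// sqrtr_ge0.
have c2 : 0 < c ^+ 2 <= 1.
  rewrite expr2; apply/andP; split; last exact: sq.
  by move: Jc; rewrite /cube_side /= in_itv /= => /andP[]; nra.
have /andP[c20 c21] := c2.
apply/andP; split; first by rewrite powR_gt0 /=; lra.
by apply: ge0_ler_powR; rewrite ?nnegrE /=; lra.
Qed.

End kernel.

Section kernel_bounds.
Context {R : realType} {n : nat} (n_gt0 : (0 < n)%N).
Notation H := (heisM R n).
Notation mu := (heis_lebesgue R n).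
Notation x1 := (heis_x1 n_gt0).
Notation Q := (heis_dim n).
Notation cube := (@test_cube R n).

(** A bound from below for both kernels on [test_cube], uniform in s: the values
    of |x_1|^p there are at least 2^(-p). *)
Definition cube_density (p : R) : R :=
  2 `^ (- p) / cube_radius (R := R) (n := n) `^ (Q%:R + p).

Definition kernel_constant (p : R) : R :=
  2 `^ (- p) * (cube_density p * 2^-1 ^+ (n + n + 1)).

Lemma cube_density_gt0 (p : R) : 0 < cube_density p.
Proof.
by rewrite divr_gt0 ?powR_gt0// (lt_le_trans ltr01)// cube_radius_ge1.
Qed.

Lemma kernel_constant_gt0 (p : R) : 0 < kernel_constant p.
Proof.
apply: mulr_gt0; first by rewrite powR_gt0.
by apply: mulr_gt0; [exact: cube_density_gt0|exact: exprn_gt0].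
Qed.

Lemma heis_x1_test_cube (k : H) : cube k -> -1 < x1 k <= - 2^-1.
Proof.
move=> [[/= Ja _] _]; have := Ja (Ordinal n_gt0).
by rewrite /cube_side /= in_itv.
Qed.

Lemma test_cube_kernel (s p : R) (k : H) : 0 < s -> s < 1 -> 0 < p -> cube k ->
  cube_density p <= 2 `^ (- p) / heis_norm k `^ (Q%:R + s * p).
Proof.
move=> s0 s1 p0 /heis_norm_test_cube /andP[d0 dD].
have sp0 : 0 <= s * p by rewrite mulr_ge0 ?ltW.
have D1 := @cube_radius_ge1 R n.
have D0 := lt_le_trans ltr01 D1.
rewrite /cube_density; set D := cube_radius in dD D1 D0 *.
set d := heis_norm k in d0 dD *.
have e0 : 0 <= Q%:R + s * p by rewrite addr_ge0.
have H1 : d `^ (Q%:R + s * p) <= D `^ (Q%:R + s * p).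
  by apply: ge0_ler_powR => //; rewrite nnegrE ltW.
have H2 : D `^ (Q%:R + s * p) <= D `^ (Q%:R + p).
  by apply: ler_powR => //; rewrite lerD2l ler_piMl// ltW.
have d1 : 0 < d `^ (Q%:R + s * p) by exact: powR_gt0.
have D2 : 0 < D `^ (Q%:R + p) by exact: powR_gt0.
apply: ler_wpM2l; first exact: powR_ge0.
exact: (ler_inv d1 (le_trans H1 H2)).
Qed.

(** The form of [self_similar_integral] common to both kernels; the bound
    sg <= p makes the constant independent of s. *)
Lemma kernel_lower_bound (h : H -> R) (p r sg : R) : 0 < r -> 0 < sg -> sg <= p ->
  measurable_fun setT h -> (forall k, 0 <= h k) ->
  (forall k, 2 `^ (- sg) * (h k + cube_density p * \1_cube k)
             <= r ^+ Q * h (dilation r k)) ->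
  ((kernel_constant p / sg)%:E <= \int[mu]_k (h k)%:E)%E.
Proof.
move=> r0 sg0 sgp mh h0 hw.
have mcube : measurable cube by exact: measurable_test_cube.
have c0 := ltW (cube_density_gt0 p).
have W : (\int[mu]_k (cube_density p * \1_cube k)%:E =
    (cube_density p * 2^-1 ^+ (n + n + 1))%:E)%E.
  under eq_integral do rewrite EFinM.
  rewrite ge0_integralZl_EFin//; last by apply/measurable_EFinP; exact: measurable_indic.
  rewrite integral_indic// setIT [RHS]EFinM; congr (_ * _)%E.
  exact: heis_lebesgue_test_cube.
have mw : measurable_fun setT (fun k : H => cube_density p * \1_cube k).
  by apply: measurable_funM => //; exact: measurable_indic.
have w0 k : 0 <= cube_density p * \1_cube k by rewrite mulr_ge0.
apply: le_trans (self_similar_integral r0 sg0 mh mw h0 w0 hw).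
rewrite W -EFinM lee_fin /kernel_constant mulrAC.
apply: ler_wpM2r; first by rewrite mulr_ge0// exprn_ge0.
apply: ler_wpM2r; first by rewrite invr_ge0 ltW.
by apply: ler_powR; [rewrite ler1n|rewrite lerN2].
Qed.

(** Up to a constant factor, each of the two weights bounds from below the
    fraction of the Hardy integral that a moving shift by k costs; see
    [shift_energy_far] and [shift_energy_near]. *)
Definition far_weight (k : H) : R := (x1 k <= -1)%R%:R.

Definition near_weight (p : R) (k : H) : R :=
  (- 2^-1 < x1 k < 0)%R%:R * `|x1 k| `^ p.

Definition far_kernel (s p : R) (k : H) : R :=
  far_weight k / heis_norm k `^ (Q%:R + s * p).

Definition near_kernel (s p : R) (k : H) : R :=
  near_weight p k / heis_norm k `^ (Q%:R + s * p).

Lemma near_weight_ge0 p k : 0 <= near_weight p k.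
Proof. by rewrite mulr_ge0 ?powR_ge0. Qed.

Lemma measurable_far_weight : measurable_fun setT far_weight.
Proof.
apply: measurable_bool_natr; apply: measurable_fun_ler => //.
exact: measurable_heis_x1.
Qed.

Lemma measurable_near_weight p : measurable_fun setT (near_weight p).
Proof.
have m1 := measurable_heis_x1 n_gt0 (@measurable_id _ H setT).
apply: measurable_funM; last exact: measurable_abs_powR.
by apply: measurable_bool_natr; apply: measurable_and; exact: measurable_fun_ltr.
Qed.

Lemma measurable_far_kernel s p : measurable_fun setT (far_kernel s p).
Proof.
apply: measurable_funM; first exact: measurable_far_weight.
by apply: measurable_powRV; exact: measurable_heis_norm.
Qed.

Lemma measurable_near_kernel s p : measurable_fun setT (near_kernel s p).
Proof.
apply: measurable_funM; first exact: measurable_near_weight.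
by apply: measurable_powRV; exact: measurable_heis_norm.
Qed.

(** The dilation by 2 pulls the region x_1 <= -1 back to x_1 <= -1/2, and the
    powers of 2 add up to Q - (Q + s p) = - s p. *)
Lemma integral_far_kernel_ge (s p : R) : 0 < s -> s < 1 -> 0 < p ->
  ((kernel_constant p / (s * p))%:E <= \int[mu]_k (far_kernel s p k)%:E)%E.
Proof.
move=> s0 s1 p0.
have h0 k : 0 <= far_kernel s p k by rewrite mulr_ge0// invr_ge0 powR_ge0.
apply: (@kernel_lower_bound _ p 2) => //.
- exact: mulr_gt0.
- by rewrite ler_piMl// ltW.
- exact: measurable_far_kernel.
move=> k; set sg := s * p.
rewrite {2}/far_kernel /far_weight heis_norm_dilation// heis_x1_dilation.
rewrite powRM ?heis_norm_ge0//.
have -> : 2 ^+ Q * ((2 * x1 k <= -1)%R%:R /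
    (2 `^ (Q%:R + sg) * heis_norm k `^ (Q%:R + sg)))
  = 2 `^ (- sg) * ((2 * x1 k <= -1)%R%:R / heis_norm k `^ (Q%:R + sg)) :> R.
  rewrite powRD ?pnatr_eq0 ?implybT// powR_mulrn// powRN !invfM.
  have E : 2 ^+ Q / 2 ^+ Q = 1 :> R by rewrite mulfV// expf_neq0.
  by rewrite -[RHS]mul1r -[X in _ = X * _]E; ring.
rewrite ler_wpM2l ?powR_ge0//.
have [kc|kc] := pselect (cube k).
  have /andP[k1 k2] := heis_x1_test_cube kc.
  rewrite indicE mem_set// mulr1 /far_kernel /far_weight.
  rewrite (_ : (x1 k <= -1) = false) ?mul0r ?add0r; last by rewrite leNgt k1.
  rewrite (_ : 2 * x1 k <= -1); last by lra.
  apply: le_trans (test_cube_kernel s0 s1 p0 kc) _.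
  rewrite ler_wpM2r ?invr_ge0 ?powR_ge0//.
  apply: (@le_trans _ _ (2 `^ 0)); last by rewrite powRr0.
  by apply: ler_powR; rewrite ?ler1n// oppr_le0 ltW.
rewrite indicE memNset// mulr0 addr0 /far_kernel /far_weight.
rewrite ler_wpM2r ?invr_ge0 ?powR_ge0// ler_nat.
by case: (leP (x1 k) (-1)) => // k1; rewrite (_ : 2 * x1 k <= -1)//; lra.
Qed.

(** The dilation by 1/2 pulls the region -1/2 < x_1 < 0 back to -1 < x_1 < 0, and
    the powers of 2 add up to - Q - p + (Q + s p) = - p (1 - s). *)
Lemma integral_near_kernel_ge (s p : R) : 0 < s -> s < 1 -> 0 < p ->
  ((kernel_constant p / (p * (1 - s)))%:E <= \int[mu]_k (near_kernel s p k)%:E)%E.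
Proof.
move=> s0 s1 p0; have s1' : 0 < 1 - s by lra.
have h0 k : 0 <= near_kernel s p k.
  by rewrite !mulr_ge0 ?powR_ge0// invr_ge0 powR_ge0.
have half0 : 0 < 2^-1 :> R by [].
apply: (@kernel_lower_bound _ p 2^-1) => //.
- exact: mulr_gt0.
- by rewrite ler_piMr// ?ltW//; lra.
- exact: measurable_near_kernel.
move=> k; set sg := p * (1 - s).
rewrite {2}/near_kernel /near_weight heis_norm_dilation ?(ltW half0)// heis_x1_dilation.
rewrite powRM ?heis_norm_ge0 ?(ltW half0)//.
rewrite normrM (gtr0_norm half0) powRM ?(ltW half0)//.
set e := Q%:R + s * p.
have -> : 2^-1 ^+ Q * ((- 2^-1 < 2^-1 * x1 k < 0)%R%:R *
    (2^-1 `^ p * `|x1 k| `^ p) / (2^-1 `^ e * heis_norm k `^ e))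
  = 2 `^ (- sg) * ((-1 < x1 k < 0)%R%:R * `|x1 k| `^ p / heis_norm k `^ e) :> R.
  rewrite (_ : (- 2^-1 < 2^-1 * x1 k < 0) = (-1 < x1 k < 0)); last first.
    by congr andb; apply/idP/idP; lra.
  have P : 2^-1 ^+ Q * 2^-1 `^ p / 2^-1 `^ e = 2 `^ (- sg) :> R.
    rewrite -powR_mulrn ?ltW// -powRD ?(gt_eqF half0) ?implybT//.
    rewrite -powRB ?(gt_eqF half0) ?implybT//.
    rewrite -powR_inv1// -powRrM; congr (_ `^ _); rewrite /e /sg; ring.
  rewrite -P invfM; ring.
rewrite ler_wpM2l ?powR_ge0//.
have [kc|kc] := pselect (cube k).
  have /andP[k1 k2] := heis_x1_test_cube kc.
  rewrite indicE mem_set// mulr1 /near_kernel /near_weight.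
  rewrite (_ : (- 2^-1 < x1 k) = false) ?mul0r ?add0r; last by rewrite ltNge k2.
  rewrite k1 (_ : x1 k < 0) /=; last by lra.
  apply: le_trans (test_cube_kernel s0 s1 p0 kc) _.
  rewrite mul1r ler_wpM2r ?invr_ge0 ?powR_ge0//.
  rewrite powRN -powR_inv1 ?powR_ge0// -powRrM mulrN1 -mulN1r powRrM powR_inv1//.
  apply: ge0_ler_powR; rewrite ?nnegrE ?(ltW p0) ?(ltW half0)//.
  by rewrite ltr0_norm; lra.
rewrite indicE memNset// mulr0 addr0 /near_kernel /near_weight.
rewrite !ler_wpM2r ?invr_ge0 ?powR_ge0// ler_nat.
case: (boolP (- 2^-1 < x1 k < 0)) => // /andP[k1 k2].
by rewrite k2 andbT (_ : -1 < x1 k)//; lra.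
Qed.

End kernel_bounds.

(** * The energy of a moving shift *)

Section gagliardo.
Context {R : realType} {n : nat} (n_gt0 : (0 < n)%N).
Notation H := (heisM R n).
Notation mu := (heis_lebesgue R n).
Notation x1 := (heis_x1 n_gt0).
Notation Q := (heis_dim n).
Variables (s p : R) (f : H -> R).
Hypothesis mf : measurable_fun setT f.
Hypothesis f_out : forall xi, x1 xi <= 0 -> f xi = 0.

(** Thanks to the indicator, all integrals are over the whole group. *)
Definition hardy_weight (xi : H) : R := (0 < x1 xi)%R%:R / x1 xi `^ (s * p).

Definition hardy_integral : \bar R :=
  (\int[mu]_xi (`|f xi| `^ p * hardy_weight xi)%:E)%E.

(** The right translation by k, at the scale of the distance from xi to the
    boundary. *)
Definition moving_shift (k xi : H) : H := heis_mul xi (dilation (x1 xi) k).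

Definition shift_energy (k : H) : \bar R :=
  (\int[mu]_xi (`|f xi - f (moving_shift k xi)| `^ p * hardy_weight xi)%:E)%E.

Lemma hardy_weight_ge0 xi : 0 <= hardy_weight xi.
Proof. by rewrite mulr_ge0// invr_ge0 powR_ge0. Qed.

Lemma weighted_powR_ge0 (u : R) xi : (0 <= (`|u| `^ p * hardy_weight xi)%:E)%E.
Proof. by rewrite lee_fin; exact: mulr_ge0 (powR_ge0 _ _) (hardy_weight_ge0 _). Qed.

Lemma heis_x1_moving_shift k xi : x1 (moving_shift k xi) = (1 + x1 k) * x1 xi.
Proof. by rewrite heis_x1_mul heis_x1_dilation; ring. Qed.

Lemma measurable_hardy_weight : measurable_fun setT hardy_weight.
Proof.
have m1 := measurable_heis_x1 n_gt0 (@measurable_id _ H setT).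
apply: measurable_funM; last exact: measurable_powRV.
by apply: measurable_bool_natr; exact: measurable_fun_ltr.
Qed.

Lemma measurable_moving_shift :
  measurable_fun setT (fun z : H * H => moving_shift z.2 z.1).
Proof.
apply: measurable_heis_mul => //; apply: measurable_dilation => //.
exact: measurable_heis_x1.
Qed.

Lemma measurable_heis_inv : measurable_fun setT (fun xi : H => heis_inv xi : H).
Proof.
rewrite (_ : (fun _ => _) =
    (fun xi : H => ((-1) *: xi.1.1, (-1) *: xi.1.2, - xi.2))); last first.
  by apply/funext => -[[x y] t]; rewrite !scaleN1r.
have m11 : measurable_fun setT (fun xi : H => xi.1.1).
  exact: (measurableT_comp measurable_fst measurable_fst).
have m12 : measurable_fun setT (fun xi : H => xi.1.2).
  exact: (measurableT_comp measurable_snd measurable_fst).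
apply/measurable_fun_pair; first apply/measurable_fun_pair.
- exact: measurable_rVZ.
- exact: measurable_rVZ.
- exact: measurableT_comp.
Qed.

Definition gagliardo_quotient (xi xi' : H) : R :=
  `|f xi - f xi'| `^ p /
  heis_norm (heis_mul (heis_inv xi) xi') `^ (Q%:R + s * p).

Lemma gagliardo_quotient_ge0 xi xi' : 0 <= gagliardo_quotient xi xi'.
Proof. by rewrite divr_ge0// powR_ge0. Qed.

Lemma measurable_gagliardo_quotient :
  measurable_fun setT (fun z : H * H => gagliardo_quotient z.1 z.2).
Proof.
apply: measurable_funM.
  apply: measurable_abs_powR; apply: measurable_funB; exact: (measurableT_comp mf).
apply: measurable_powRV; apply: measurable_heis_norm; apply: measurable_heis_mul => //.
exact: (measurableT_comp measurable_heis_inv measurable_fst).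
Qed.

(** If x_1 > 0, this is the difference quotient at xi' = [moving_shift k xi] times
    the Jacobian of the substitution, as [shifted_quotientE] shows. *)
Definition shifted_quotient (xi k : H) : R :=
  `|f xi - f (moving_shift k xi)| `^ p * hardy_weight xi /
  heis_norm k `^ (Q%:R + s * p).

Lemma shifted_quotient_ge0 xi k : 0 <= shifted_quotient xi k.
Proof. by rewrite divr_ge0 ?powR_ge0// mulr_ge0 ?powR_ge0// hardy_weight_ge0. Qed.

Lemma measurable_shift_difference :
  measurable_fun setT (fun z : H * H =>
    `|f z.1 - f (moving_shift z.2 z.1)| `^ p * hardy_weight z.1).
Proof.
apply: measurable_funM; last exact: (measurableT_comp measurable_hardy_weight).
apply: measurable_abs_powR; apply: measurable_funB; first exact: (measurableT_comp mf).
exact: (measurableT_comp mf measurable_moving_shift).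
Qed.

Lemma measurable_shifted_quotient :
  measurable_fun setT (fun z : H * H => shifted_quotient z.1 z.2).
Proof.
apply: measurable_funM; first exact: measurable_shift_difference.
by apply: measurable_powRV; exact: measurable_heis_norm.
Qed.

Lemma shifted_quotientE xi k : 0 < x1 xi ->
  x1 xi ^+ Q * gagliardo_quotient xi (moving_shift k xi) = shifted_quotient xi k.
Proof.
move=> x10; rewrite /gagliardo_quotient /shifted_quotient /hardy_weight x10.
rewrite /moving_shift heis_mulKV heis_norm_dilation ?(ltW x10)//.
rewrite powRM ?heis_norm_ge0 ?(ltW x10)// powRD ?(gt_eqF x10) ?implybT//.
rewrite powR_mulrn ?(ltW x10)// !invfM.
have E : x1 xi ^+ Q / x1 xi ^+ Q = 1 by rewrite mulfV// expf_neq0// gt_eqF.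
rewrite -[RHS]mul1r -[X in _ = X * _]E /=; ring.
Qed.

(** The substitution xi' = [moving_shift k xi] gives an equality if x_1 > 0, and
    otherwise the left-hand side vanishes. *)
Lemma integral_shifted_quotient_le xi :
  (\int[mu]_k (shifted_quotient xi k)%:E <=
   \int[mu]_xi' (gagliardo_quotient xi xi')%:E)%E.
Proof.
have mG : measurable_fun setT (fun xi' : H => gagliardo_quotient xi xi').
  exact: (measurableT_comp measurable_gagliardo_quotient (measurable_pair1 _)).
have [x10|x10] := ltP 0 (x1 xi); last first.
  apply: (@le_trans _ _ 0%E).
    rewrite le_eqVlt; apply/orP; left; apply/eqP; apply: integral0_eq => k _.
    by rewrite /shifted_quotient /hardy_weight ltNge x10 /= mul0r mulr0 mul0r.
  by apply: integral_ge0 => xi' _; rewrite lee_fin gagliardo_quotient_ge0.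
have [_ mphi E] := rescales_left_dilation (xi : heisenberg R n) x10.
rewrite [leRHS]E; last 2 first.
- exact/measurable_EFinP.
- by move=> xi'; rewrite lee_fin gagliardo_quotient_ge0.
rewrite -ge0_integralZl//; last 3 first.
- by apply/measurable_EFinP; exact: (measurableT_comp mG mphi).
- by move=> k _; rewrite lee_fin gagliardo_quotient_ge0.
- by rewrite lee_fin exprn_ge0// ltW.
rewrite le_eqVlt; apply/orP; left; apply/eqP; apply: eq_integral => k _.
by rewrite -EFinM -shifted_quotientE.
Qed.

Lemma hardy_integral_ge0 : (0 <= hardy_integral)%E.
Proof. by apply: integral_ge0 => xi _; exact: weighted_powR_ge0. Qed.

Lemma shift_energy_ge0 k : (0 <= shift_energy k)%E.
Proof. by apply: integral_ge0 => xi _; exact: weighted_powR_ge0. Qed.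

(** After the substitution for xi' the integrals are exchanged, so that for each
    k the kernel factors out and leaves the shift energy. *)
Lemma gagliardo_energy_ge (M : H -> R) :
  measurable_fun setT M -> (forall k, 0 <= M k) ->
  (forall k, (M k)%:E * hardy_integral <= shift_energy k)%E ->
  (\int[mu]_k (M k / heis_norm k `^ (Q%:R + s * p))%:E * hardy_integral <=
   \int[mu]_xi \int[mu]_xi' (gagliardo_quotient xi xi')%:E)%E.
Proof.
move=> mM M0 MI.
have I0 := hardy_integral_ge0.
have mP : measurable_fun setT (fun z : H * H => (shifted_quotient z.1 z.2)%:E).
  by apply/measurable_EFinP; exact: measurable_shifted_quotient.
have mG : measurable_fun setT (fun z : H * H => (gagliardo_quotient z.1 z.2)%:E).
  by apply/measurable_EFinP; exact: measurable_gagliardo_quotient.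
have P0 (z : H * H) : (0 <= (shifted_quotient z.1 z.2)%:E)%E.
  by rewrite lee_fin shifted_quotient_ge0.
have G0 (z : H * H) : (0 <= (gagliardo_quotient z.1 z.2)%:E)%E.
  by rewrite lee_fin gagliardo_quotient_ge0.
have mk : measurable_fun setT (fun k : H => (heis_norm k `^ (Q%:R + s * p))^-1).
  by apply: measurable_powRV; exact: measurable_heis_norm.
apply: (@le_trans _ _
  (\int[mu]_xi \int[mu]_k (shifted_quotient xi k)%:E)%E); last first.
  apply: ge0_le_integral; first exact: measurableT.
  - by move=> xi _; apply: integral_ge0 => k _; exact: (P0 (xi, k)).
  - exact: (measurable_fun_fubini_tonelli_F (m2 := mu) _ mP P0).
  - exact: (measurable_fun_fubini_tonelli_F (m2 := mu) _ mG G0).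
  - by move=> xi _; exact: integral_shifted_quotient_le.
rewrite (fubini_tonelli (m1 := mu) (m2 := mu) _ mP P0) /=.
have mMk : measurable_fun setT
    (fun k : H => (M k / heis_norm k `^ (Q%:R + s * p))%:E).
  by apply/measurable_EFinP; exact: measurable_funM.
have Mk0 k : 0 <= M k / heis_norm k `^ (Q%:R + s * p) by rewrite divr_ge0// powR_ge0.
rewrite -ge0_integralZr//; last by move=> k _; rewrite lee_fin.
apply: ge0_le_integral; first exact: measurableT.
- by move=> k _; rewrite mule_ge0// lee_fin.
- exact: emeasurable_funM.
- exact: (measurable_fun_fubini_tonelli_G (m1 := mu) _ mP P0).
move=> k _.
have mD : measurable_fun setT (fun xi : H =>
    (`|f xi - f (moving_shift k xi)| `^ p * hardy_weight xi)%:E).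
  apply/measurable_EFinP.
  exact: (measurableT_comp measurable_shift_difference (measurable_pair2 k)).
have kV0 : 0 <= (heis_norm k `^ (Q%:R + s * p))^-1 by rewrite invr_ge0 powR_ge0.
rewrite /shifted_quotient; under [leRHS]eq_integral do rewrite EFinM.
rewrite ge0_integralZr//; last by move=> xi _; exact: weighted_powR_ge0.
rewrite EFinM -muleA (muleC _ hardy_integral) muleA.
by apply: lee_wpmul2r; [rewrite lee_fin|exact: MI].
Qed.

(** Such a shift leaves the half-space, outside of which f vanishes. *)
Lemma shift_energy_far k : x1 k <= -1 -> shift_energy k = hardy_integral.
Proof.
move=> k1; apply: eq_integral => xi _; rewrite /hardy_weight.
have [x10|_] := ltP 0 (x1 xi); last by rewrite mul0r !mulr0.
rewrite (f_out (xi := moving_shift k xi)) ?subr0//.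
by rewrite heis_x1_moving_shift; nra.
Qed.

(** The shift multiplies x_1 by 1 + k_1, and the measure too. *)
Lemma integral_moving_shift k : -1 < x1 k ->
  (\int[mu]_xi (`|f (moving_shift k xi)| `^ p * hardy_weight xi)%:E =
   ((1 + x1 k) `^ (s * p - 1))%:E * hardy_integral)%E.
Proof.
move=> k1; have l0 : 0 < 1 + x1 k by lra.
have mg : measurable_fun setT (fun xi => `|f xi| `^ p * hardy_weight xi).
  apply: measurable_funM; last exact: measurable_hardy_weight.
  exact: measurable_abs_powR.
have g0 xi : 0 <= `|f xi| `^ p * hardy_weight xi.
  by rewrite mulr_ge0 ?powR_ge0// hardy_weight_ge0.
have [_ mphi E] := rescales_moving_shear l0.
have W xi : hardy_weight xi =
    (1 + x1 k) `^ (s * p) * hardy_weight (moving_shift k xi).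
  rewrite /hardy_weight heis_x1_moving_shift pmulr_rgt0//.
  have [x10|_] := ltP 0 (x1 xi); last by rewrite !mul0r mulr0.
  have X : (1 + x1 k) `^ (s * p) != 0 by rewrite gt_eqF// powR_gt0.
  by rewrite powRM ?(ltW l0) ?(ltW x10)// invfM mulrCA !mulrA mulfK.
transitivity (((1 + x1 k) `^ (s * p))%:E *
    \int[mu]_xi (`|f (moving_shift k xi)| `^ p *
      hardy_weight (moving_shift k xi))%:E)%E.
  rewrite -ge0_integralZl; first last.
  - by rewrite lee_fin powR_ge0.
  - by move=> xi _; rewrite lee_fin.
  - by apply/measurable_EFinP; exact: (measurableT_comp mg mphi).
  - exact: measurableT.
  apply: eq_integral => xi _.
  by rewrite -EFinM {1}W; congr EFin; ring.
rewrite /hardy_integral [in RHS]E; last 2 first.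
- exact/measurable_EFinP.
- by move=> xi; rewrite lee_fin; exact: g0.
rewrite muleA -EFinM; congr (_%:E * _)%E.
by rewrite powRB ?(gt_eqF l0) ?implybT// powRr1 ?(ltW l0)// divfK ?gt_eqF.
Qed.

(** For th = (1 + k_1)^a, the inequality [powR_triangle] integrates to
    I <= (1 - th)^(1-p) E + th I, where I is the Hardy integral and E the shift
    energy.  As I is finite, it follows that (1 - th)^p I <= E. *)
Lemma shift_energy_near k (a : R) : 1 <= p -> a = s - p^-1 -> 0 < a <= 1 ->
  -1 < x1 k < 0 -> (hardy_integral < +oo)%E ->
  (((a * `|x1 k| / 2) `^ p)%:E * hardy_integral <= shift_energy k)%E.
Proof.
move=> p1 aE /andP[a0 a1] /andP[k1 k2] Ioo.
have p0 : 0 < p by lra.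
have l0 : 0 < 1 + x1 k by lra.
have I0 := hardy_integral_ge0.
have S0 := shift_energy_ge0 k.
pose th := (1 + x1 k) `^ a.
have th0 : 0 < th by exact: powR_gt0.
have v01 : 0 <= `|x1 k| < 1 by rewrite normr_ge0 ltr0_norm//; lra.
have thv : a * `|x1 k| / 2 <= 1 - th.
  have a01 : 0 <= a <= 1 by rewrite a1 ltW.
  have := one_minus_powR_ge a01 v01.
  by rewrite {2}ltr0_norm// opprK.
have av0 : 0 < a * `|x1 k| / 2 by rewrite !mulr_gt0// ltr0_norm//; lra.
have th1 : th < 1 by lra.
have mT : measurable_fun setT (moving_shift k).
  exact: (measurableT_comp measurable_moving_shift (measurable_pair2 k)).
have mD : measurable_fun setT (fun xi : H =>
    `|f xi - f (moving_shift k xi)| `^ p * hardy_weight xi).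
  exact: (measurableT_comp measurable_shift_difference (measurable_pair2 k)).
have mE : measurable_fun setT (fun xi : H =>
    `|f (moving_shift k xi)| `^ p * hardy_weight xi).
  apply: measurable_funM; last exact: measurable_hardy_weight.
  by apply: measurable_abs_powR; exact: measurableT_comp mf mT.
have tri : (hardy_integral <= ((1 - th) `^ (1 - p))%:E * shift_energy k +
    th%:E * hardy_integral)%E.
  (* The exponent works out because a (1 - p) + (s p - 1) = a. *)
  have -> : (th%:E * hardy_integral = (th `^ (1 - p))%:E *
      \int[mu]_xi (`|f (moving_shift k xi)| `^ p * hardy_weight xi)%:E)%E.
    rewrite integral_moving_shift// muleA -EFinM; congr (_%:E * _)%E.
    rewrite /th -powRrM -powRD ?(gt_eqF l0) ?implybT//; congr (_ `^ _).
    rewrite aE; field; exact: lt0r_neq0.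
  rewrite -ge0_integralZl; first last.
  - by rewrite lee_fin powR_ge0.
  - by move=> xi _; exact: weighted_powR_ge0.
  - exact/measurable_EFinP.
  - exact: measurableT.
  rewrite -ge0_integralZl; first last.
  - by rewrite lee_fin powR_ge0.
  - by move=> xi _; exact: weighted_powR_ge0.
  - exact/measurable_EFinP.
  - exact: measurableT.
  rewrite -ge0_integralD; first last.
  - by apply: measurable_funeM; exact/measurable_EFinP.
  - by move=> xi _; apply: mule_ge0; [rewrite lee_fin powR_ge0|exact: weighted_powR_ge0].
  - by apply: measurable_funeM; exact/measurable_EFinP.
  - by move=> xi _; apply: mule_ge0; [rewrite lee_fin powR_ge0|exact: weighted_powR_ge0].
  - exact: measurableT.
  apply: ge0_le_integral; first exact: measurableT.
  - by move=> xi _; exact: weighted_powR_ge0.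
  - apply/measurable_EFinP; apply: measurable_funM; last exact: measurable_hardy_weight.
    exact: measurable_abs_powR.
  - by apply: emeasurable_funD; apply: measurable_funeM; exact/measurable_EFinP.
  move=> xi _; rewrite -!EFinM -EFinD lee_fin.
  have th01 : 0 < th < 1 by rewrite th0.
  have := ler_wpM2r (hardy_weight_ge0 xi)
    (powR_triangle (f xi) (f (moving_shift k xi)) p1 th01).
  by rewrite mulrDl -(mulrA (_ `^ _)) -(mulrA (th `^ _)).
move: tri Ioo I0 S0; case: hardy_integral => [I| |] //.
case: (shift_energy k) => [S| |] //; last by move=> *; rewrite leey.
rewrite -!EFinM -EFinD !lee_fin => tri _ I0 S0.
have w0 : 0 < 1 - th by lra.
have H1 : (1 - th) `^ p * I <= S.
  have : (1 - th) * I <= (1 - th) `^ (1 - p) * S by lra.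
  rewrite powRB ?(gt_eqF w0) ?implybT// powRr1 ?(ltW w0)//.
  by rewrite mulrAC -mulrA ler_pM2l// ler_pdivlMr ?powR_gt0// mulrC.
apply: le_trans H1; apply: ler_wpM2r => //.
by apply: ge0_ler_powR; rewrite ?nnegrE ?(ltW p0) ?(ltW av0) ?(ltW w0).
Qed.

Definition gagliardo_energy : \bar R :=
  (\int[mu]_xi \int[mu]_xi' (gagliardo_quotient xi xi')%:E)%E.

Hypotheses (s_gt0 : 0 < s) (s_lt1 : s < 1).

(** Only the shifts that leave the half-space are kept. *)
Lemma hardy_far : 0 < p ->
  ((@kernel_constant R n p / (s * p))%:E * hardy_integral <=
   gagliardo_energy)%E.
Proof.
move=> p0.
have far k : ((far_weight n_gt0 k)%:E * hardy_integral <= shift_energy k)%E.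
  rewrite /far_weight; have [k1|_] := leP (x1 k) (-1).
    by rewrite mul1e shift_energy_far.
  by rewrite mul0e shift_energy_ge0.
have := gagliardo_energy_ge (measurable_far_weight n_gt0)
  (fun=> ler0n _ _) far.
apply: le_trans; apply: lee_wpmul2r; first exact: hardy_integral_ge0.
exact: integral_far_kernel_ge.
Qed.

(** Only the shifts that move xi towards the boundary, by less than half of its
    distance, are kept. *)
Lemma hardy_near (a : R) : 1 <= p -> 0 < a -> a <= s - p^-1 ->
  (hardy_integral < +oo)%E ->
  (((a / 2) `^ p * (@kernel_constant R n p / (p * (1 - s))))%:E *
     hardy_integral <= gagliardo_energy)%E.
Proof.
move=> p1 a0 aa Ioo; have p0 : 0 < p by lra.
have ip0 : 0 < p^-1 by rewrite invr_gt0.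
have a20 : 0 < a / 2 by lra.
have A0 : 0 < (a / 2) `^ p by exact: powR_gt0.
set A := (a / 2) `^ p in A0 *.
have near k : ((A * near_weight n_gt0 p k)%:E * hardy_integral <=
    shift_energy k)%E.
  rewrite /near_weight.
  case: (boolP (_ < _ < _)%R) => [/andP[k1 k2]|_]; last first.
    by rewrite mul0r mulr0 mul0e shift_energy_ge0.
  have k11 : -1 < x1 k < 0 by rewrite k2 andbT; lra.
  have a01 : 0 < s - p^-1 <= 1.
    by move: s_lt1 => s1; apply/andP; split; lra.
  apply: le_trans (shift_energy_near p1 (erefl _) a01 k11 Ioo).
  apply: lee_wpmul2r; first exact: hardy_integral_ge0.
  rewrite lee_fin mul1r /A -powRM ?(ltW a20)//.
  have n0 := normr_ge0 (x1 k).
  have aN : a / 2 * `|x1 k| <= (s - p^-1) * `|x1 k| / 2 by nra.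
  apply: ge0_ler_powR; rewrite ?nnegrE ?(ltW p0)//.
    by rewrite mulr_ge0 ?(ltW a20).
  by apply: le_trans aN; rewrite mulr_ge0 ?(ltW a20).
have mN : measurable_fun setT (fun k => A * near_weight n_gt0 p k).
  by apply: measurable_funM => //; exact: measurable_near_weight.
have AN0 k : 0 <= A * near_weight n_gt0 p k.
  by rewrite mulr_ge0 ?(ltW A0) ?near_weight_ge0.
apply: le_trans (gagliardo_energy_ge mN AN0 near).
apply: lee_wpmul2r; first exact: hardy_integral_ge0.
have -> : (\int[mu]_k
    (A * near_weight n_gt0 p k / heis_norm k `^ (Q%:R + s * p))%:E =
    A%:E * \int[mu]_k (near_kernel n_gt0 s p k)%:E)%E.
  rewrite -ge0_integralZl; first last.
  - by rewrite lee_fin ltW.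
  - by move=> k _; rewrite lee_fin divr_ge0 ?powR_ge0 ?near_weight_ge0.
  - by apply/measurable_EFinP; exact: measurable_near_kernel.
  - exact: measurableT.
  by apply: eq_integral => k _; rewrite -EFinM -mulrA.
rewrite EFinM; apply: lee_wpmul2l; first by rewrite lee_fin ltW.
exact: integral_near_kernel_ge.
Qed.

End gagliardo.

(** * Test functions have finite Hardy integral *)

Section test_functions.
Context {R : realType} {n : nat} (n_gt0 : (0 < n)%N).
Notation H := (heisM R n).
Notation mu := (heis_lebesgue R n).
Notation x1 := (heis_x1 n_gt0).

Definition heis_box (B : R) : set H := heis_cube `[- B, B]%classic.

Lemma heis_lebesgue_box_lty (B : R) : 0 < B -> (mu (heis_box B) < +oo)%E.
Proof.
move=> B0; rewrite [ltLHS](@heis_lebesgue_cube _ _ _ (B + B)) ?ltry//.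
rewrite lebesgue_measure_itv/= lte_fin ifT; last by lra.
by rewrite -EFinB opprK.
Qed.

Lemma continuous_heis_x1 : continuous (x1 : heisenberg R n -> R).
Proof.
move=> xi; apply: (cvg_comp (fun xi : heisenberg R n => xi.1.1)
  (fun v : 'rV[R]_n => v ord0 (Ordinal n_gt0))).
  by apply: (cvg_comp fst fst); exact: cvg_fst.
exact: coord_continuous.
Qed.

Lemma bounded_heis_box (B : R) (xi : heisenberg R n) : `|xi| <= B -> heis_box B xi.
Proof.
case: xi => -[x y] t; rewrite !prod_normE /= !ge_max => /andP[/andP[xB yB] tB].
split; first split; rewrite /= ?in_itv /= -?ler_norml//.
- by move=> i; rewrite in_itv /= -ler_norml (le_trans (le_mx_norm _ _)).
- by move=> i; rewrite in_itv /= -ler_norml (le_trans (le_mx_norm _ _)).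
Qed.

(** On the compact support f is bounded, x_1 is bounded away from 0, and the
    support itself lies in a box. *)
Lemma hardy_integral_lty (s p : R) (f : heisenberg R n -> R) :
  0 <= s * p -> 0 < p ->
  test_function (half_space n_gt0) f -> (hardy_integral n_gt0 s p f < +oo)%E.
Proof.
move=> sp0 p0 [sm cK sK].
have cf : continuous f := (sm [::]).1.
have mf := continuous_measurable_heis cf.
have inK xi : f xi != 0 -> supp f xi by move=> fx; exact: subset_closure.
have [M M0 fM] : exists2 M, 0 < M & forall xi, `|f xi| <= M.
  have /ex_strict_bound_gt0[M M0 fM] : bounded_set (f @` supp f).
    by apply/compact_bounded/continuous_compact => //; exact: continuous_subspaceT.
  exists M => // xi; have [->|fx] := eqVneq (f xi) 0; first by rewrite normr0 ltW.
  by apply/ltW/fM; exists xi => //; exact: inK.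
have [B B0 KB] : exists2 B, 0 < B & forall xi, supp f xi -> `|xi| <= B.
  have /ex_strict_bound_gt0[B B0 KB] := compact_bounded cK.
  by exists B => // xi Kx; exact/ltW/KB.
have [dl dl0 Kdl] : exists2 dl, 0 < dl & forall xi, supp f xi -> dl <= x1 xi.
  have [K0|/set0P/negP/negPn/eqP K0] := pselect (supp f !=set0); last first.
    by exists 1 => // xi; rewrite K0.
  have [c cin cmin] := compact_EVT_min K0 cK (continuous_subspaceT continuous_heis_x1).
  exists (x1 c); first by apply: sK; rewrite -inE.
  by move=> xi Kx; apply: cmin; rewrite inE.
have mB : measurable (heis_box B).
  by apply: measurable_heis_cube; exact: measurable_itv.
pose c := M `^ p / dl `^ (s * p).
have c0 : 0 <= c by rewrite divr_ge0 ?powR_ge0.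
have W : (\int[mu]_xi (c * \1_(heis_box B) xi)%:E = c%:E * mu (heis_box B))%E.
  under eq_integral do rewrite EFinM.
  rewrite ge0_integralZl_EFin//; last by apply/measurable_EFinP; exact: measurable_indic.
  by rewrite integral_indic// setIT.
apply: (@le_lt_trans _ _ (c%:E * mu (heis_box B))%E); last first.
  by apply: lte_mul_pinfty => //; exact: heis_lebesgue_box_lty.
rewrite -W; apply: ge0_le_integral; first exact: measurableT.
- by move=> xi _; exact: weighted_powR_ge0.
- apply/measurable_EFinP; apply: measurable_funM; last exact: measurable_hardy_weight.
  exact: measurable_abs_powR.
- by apply/measurable_EFinP; apply: measurable_funM => //; exact: measurable_indic.
move=> xi _; rewrite lee_fin.
have [->|fx] := eqVneq (f xi) 0.
  by rewrite normr0 powR0 ?gt_eqF// mul0r mulr_ge0.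
have Kx := inK _ fx; have dx := Kdl _ Kx; have x10 := lt_le_trans dl0 dx.
rewrite indicE mem_set; last exact/bounded_heis_box/KB.
rewrite mulr1 /c /hardy_weight x10 mul1r; apply: ler_pM.
- exact: powR_ge0.
- by rewrite invr_ge0 powR_ge0.
- by apply: ge0_ler_powR; rewrite ?nnegrE ?(ltW p0) ?(ltW M0).
- apply: ler_inv; first exact: powR_gt0.
  by apply: ge0_ler_powR; rewrite ?nnegrE ?(ltW dl0) ?(ltW x10).
Qed.

End test_functions.

(** * The Hardy inequality *)

Lemma hardy_integralE (R : realType) n (n_gt0 : (0 < n)%N) (s p : R)
    (f : heisenberg R n -> R) :
  (\int[heis_lebesgue R n]_(xi in half_space n_gt0)
     (`|f xi| `^ p / heis_x1 n_gt0 xi `^ (s * p))%:E = hardy_integral n_gt0 s p f)%E.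
Proof.
rewrite integral_mkcond; apply: eq_integral => xi _.
rewrite patchE /hardy_weight; case: ifPn => [|].
  by rewrite inE /half_space /= => ->; rewrite mul1r.
by rewrite notin_setE /half_space /= => /negP/negbTE ->; rewrite mul0r mulr0.
Qed.

Theorem theorem1p1 (R : realType) (n : nat) (n_gt0 : (0 < n)%N)
    (p : R) (p_gt1 : 1 < p) :
  exists C : R, 0 < C /\
    forall (s : R) (f : heisenberg R n -> R),
      0 < s -> s < 1 -> test_function (half_space n_gt0) f ->
      ((C / (s * (1 - s)))%:E *
         \int[heis_lebesgue R n]_(xi in half_space n_gt0)
           (`|f xi| `^ p / heis_x1 n_gt0 xi `^ (s * p))%:E
       <= \int[heis_lebesgue R n]_xi \int[heis_lebesgue R n]_xi'
            (`|f xi - f xi'| `^ p /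
             heis_norm (heis_mul (heis_inv xi) xi')
               `^ ((heis_dim n)%:R + s * p))%:E)%E.
Proof.
have p0 : 0 < p by lra.
have ip0 : 0 < p^-1 by rewrite invr_gt0.
have ip1 : p^-1 < 1 by rewrite invf_lt1.
pose K := @kernel_constant R n p.
have K0 : 0 < K := @kernel_constant_gt0 R n p.
(* s0 is the midpoint of 1/p and 1, and a = s0 - 1/p. *)
pose s0 := (1 + p^-1) / 2; pose a := (1 - p^-1) / 2.
have s00 : 0 < s0 by rewrite /s0; lra.
have s01 : 0 < 1 - s0 by rewrite /s0; lra.
have a0 : 0 < a by rewrite /a; lra.
have A0 : 0 < (a / 2) `^ p by apply: powR_gt0; lra.
have Kp0 : 0 < K / p by exact: divr_gt0.
pose C1 := K / p * (1 - s0); pose C2 := (a / 2) `^ p * (K / p) * s0.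
have C10 : 0 < C1 by exact: mulr_gt0.
have C20 : 0 < C2 by apply: mulr_gt0 => //; exact: mulr_gt0.
exists (Num.min C1 C2); split; first by rewrite lt_min C10.
move=> s f sgt0 slt1 tf; rewrite hardy_integralE.
have s1' : 0 < 1 - s by lra.
have [smf _ sf] := tf.
have mf := continuous_measurable_heis (smf [::]).1.
have f_out xi : heis_x1 n_gt0 xi <= 0 -> f xi = 0.
  move=> x10; apply/eqP/negPn/negP => fx.
  have : half_space n_gt0 xi by apply: sf; exact: subset_closure.
  by rewrite /half_space /= ltNge x10.
have Ioo := hardy_integral_lty (mulr_ge0 (ltW sgt0) (ltW p0)) p0 tf.
have I0 := hardy_integral_ge0 n_gt0 s p f.
have [ss0|ss0] := ltP s s0.
  apply: le_trans (hardy_far mf f_out sgt0 slt1 p0).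
  apply: lee_wpmul2r; first exact: I0.
  rewrite lee_fin; apply: (@le_trans _ _ (C1 / (s * (1 - s)))).
    apply: ler_wpM2r; first by rewrite invr_ge0 mulr_ge0 ?ltW.
    by rewrite ge_min lexx.
  rewrite -/K ler_pdivrMr ?mulr_gt0//.
  rewrite (_ : K / (s * p) * (s * (1 - s)) = K / p * (1 - s)).
    by apply: ler_wpM2l; [exact: ltW|lra].
  by field; rewrite (gt_eqF sgt0) (gt_eqF p0).
have aa : a <= s - p^-1 by rewrite /a; move: ss0; rewrite /s0; lra.
apply: le_trans (hardy_near mf sgt0 slt1 (ltW p_gt1) a0 aa Ioo).
apply: lee_wpmul2r; first exact: I0.
rewrite lee_fin; apply: (@le_trans _ _ (C2 / (s * (1 - s)))).
  apply: ler_wpM2r; first by rewrite invr_ge0 mulr_ge0 ?ltW.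
  by rewrite ge_min lexx orbT.
rewrite -/K ler_pdivrMr ?mulr_gt0//.
rewrite (_ : (a / 2) `^ p * (K / (p * (1 - s))) * (s * (1 - s)) =
  (a / 2) `^ p * (K / p) * s).
  by apply: ler_wpM2l => //; rewrite mulr_ge0 ?ltW.
by field; rewrite (gt_eqF p0) (gt_eqF s1').
Qed.
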